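(* Let $A\in\mathbb{C}^{n\times n}$, $B\in\mathbb{C}^{n\times m}$, $C\in\mathbb{C}^{p\times n}$, $D\in\mathbb{C}^{p\times m}$, and let $E\in\mathbb{C}^{n\times n}$ be invertible. Let $\varepsilon>0$ with $\varepsilon\|D\|_2<1$, and set $\gamma=\varepsilon^{-1}$. Assume that for every $\lambda\in\sigma_\varepsilon(A,B,C,D,E)$ with $\lambda\notin\sigma(A,E)$ the largest singular value of $G(\lambda)$ is simple. Let $\eta>0$ be such that the circle of radius $\eta$ centered at the origin both encircles all the eigenvalues of $(A,E)$ and is strictly in the interior of $\sigma_\varepsilon(A,B,C,D,E)$. Let $\delta>0$ be the largest value such that, for all $t\in[0,1]$, the circle of radius $\eta+t\delta$ centered at the origin is still a subset of $\sigma_\varepsilon(A,B,C,D,E)$. Let $\theta\in[0,2\pi)$ be chosen (uniformly) at random, and let $R=\{r_1,\ldots,r_l\}$ be the set of radii $r>\eta$ such that $r e^{\mathbf{i}\theta}$ is a boundary point of $\sigma_\varepsilon(A,B,C,D,E)$. Let $\hat r=\min\{r_1,\ldots,r_l\}>\eta$. Then one of the following two scenarios holds: 1. the matrix pencil $(\mathcal{S}_{\gamma r},\mathcal{T}_{\gamma r})$ is singular for $r=\eta+\delta$, but $\hat r=\eta+\delta=\rho_\varepsilon(A,B,C,D,E)$; or 2. the matrix pencil $(\mathcal{S}_{\gamma r},\mathcal{T}_{\gamma r})$ is regular for $r=\eta+\delta$ and, with probability one, $\hat r>\eta+\delta$.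
   Context: Notation: $\mathbf{i}$ is the imaginary unit, $^*$ is conjugate transpose, $\sigma(M,E)$ is the set of eigenvalues of the pencil $\lambda E-M$, also denoted $(M,E)$. For $\Delta\in\mathbb{C}^{m\times p}$ with $I-D\Delta$ invertible, $M(\Delta)=A+B\Delta(I-D\Delta)^{-1}C$. For $\varepsilon\ge 0$ with $\varepsilon\|D\|_2<1$, the $\varepsilon$-spectral value set is $$\sigma_\varepsilon(A,B,C,D,E)=\bigcup\{\sigma(M(\Delta),E):\Delta\in\mathbb{C}^{m\times p},\ \|\Delta\|_2\le\varepsilon\},$$ which is a compact subset of $\mathbb{C}$. The $\varepsilon$-spectral value set radius is $\rho_\varepsilon(A,B,C,D,E)=\max\{|\lambda|:\lambda\in\sigma_\varepsilon(A,B,C,D,E)\}$. The transfer function is $G(\lambda)=C(\lambda E-A)^{-1}B+D$ for $\lambda\in\mathbb{C}\setminus\sigma(A,E)$. A point $\lambda$ of a closed set $\mathcal{D}\subset\mathbb{C}$ is interior (strictly inside) if some neighborhood of $\lambda$ is contained in $\mathcal{D}$; a circle is strictly in the interior of $\mathcal{D}$ if all its points are interior points of $\mathcal{D}$. For $r>0$ and $\gamma>0$ not a singular value of $D$, put $R_\gamma=D^*D-\gamma^2I$, $S_\gamma=DD^*-\gamma^2I$ and $$\mathcal{S}_{\gamma r}=\begin{bmatrix}A-BR_\gamma^{-1}D^*C & -\gamma BR_\gamma^{-1}B^*\\ 0 & rE^*\end{bmatrix},\qquad \mathcal{T}_{\gamma r}=\begin{bmatrix}rE & 0\\ -\gamma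 C^*S_\gamma^{-1}C & A^*-C^*DR_\gamma^{-1}B^*\end{bmatrix}.$$ The pencil $(\mathcal{S}_{\gamma r},\mathcal{T}_{\gamma r})$ is $\lambda\mathcal{T}_{\gamma r}-\mathcal{S}_{\gamma r}$; it is singular if $\det(\lambda\mathcal{T}_{\gamma r}-\mathcal{S}_{\gamma r})=0$ for all $\lambda\in\mathbb{C}$ and regular otherwise. *)

(* Defs.v *)
From mathcomp Require Import all_boot all_order all_algebra.
From mathcomp Require Import complex.
From mathcomp Require Import all_classical all_reals all_analysis.

Set Implicit Arguments.
Unset Strict Implicit.
Unset Printing Implicit Defensive.

Import Order.TTheory GRing.Theory Num.Theory.
Import numFieldNormedType.Exports.

Local Open Scope classical_set_scope.
Local Open Scope ring_scope.
Local Open Scope complex_scope.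
Local Open Scope sesquilinear_scope.

(* R[i] is the field of complex numbers, Normc.normc the real-valued modulus,
   and M ^t* the conjugate transpose of M. *)

Section Norms.
Variable R : realType.

Definition vnorm2 k (x : 'cV[R[i]]_k) : R :=
  Num.sqrt (\sum_(i < k) Normc.normc (x i 0) ^+ 2).

(* Norm of M as an operator between Euclidean spaces. *)
Definition mxnorm2 p m (M : 'M[R[i]]_(p, m)) : R :=
  sup [set vnorm2 (M *m x) | x in [set x : 'cV[R[i]]_m | vnorm2 x <= 1]].

Definition sqrt_spectrum k (H : 'M[R[i]]_k) : seq R :=
  [seq Num.sqrt (complex.Re (spectral_diag H 0 i)) | i <- enum 'I_k].

(* The minn p m singular values of M, counted with multiplicity (unordered).
   Taking the smaller of the two Gram matrices avoids the spurious zeros that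
   the larger one contributes. *)
Definition singular_values p m (M : 'M[R[i]]_(p, m)) : seq R :=
  if (p <= m)%N then sqrt_spectrum (M *m M^t*) else sqrt_spectrum (M^t* *m M).

Definition max_singular_value p m (M : 'M[R[i]]_(p, m)) : R :=
  \big[Num.max/0]_(s <- singular_values M) s.

Definition simple_max_singular_value p m (M : 'M[R[i]]_(p, m)) : Prop :=
  count_mem (max_singular_value M) (singular_values M) = 1%N.

End Norms.

Section ComplexPlane.
Variable R : realType.

Definition maximum_of (X : set R) (x : R) : Prop := X x /\ ubound X x.
Definition minimum_of (X : set R) (x : R) : Prop := X x /\ lbound X x.

Definition circle (r : R) : set R[i] := [set z | Normc.normc z = r].

Definition cis (theta : R) : R[i] := cos theta +i* sin theta.

(* R[i]^o is R[i] with its usual topology, given by the modulus. *)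
Definition cinterior (X : set R[i]) : set R[i] := interior (X : set R[i]^o).

Definition cboundary (X : set R[i]) : set R[i] :=
  closure (X : set R[i]^o) `\` interior (X : set R[i]^o).

(* Radii r > eta at which the ray of angle theta meets the boundary of X, and
   the least of them. *)
Definition boundary_radii (X : set R[i]) (eta theta : R) : set R :=
  [set r | eta < r /\ cboundary X (r%:C * cis theta)].

Definition min_boundary_radius (X : set R[i]) (eta theta : R) : R :=
  inf (boundary_radii X eta theta).

Lemma twopi_gt0 : 0 < 2 * pi :> R.
Proof. by rewrite mulr_gt0// pi_gt0. Qed.

End ComplexPlane.

Section SpectralValueSets.
Variables (R : realType) (n m p : nat).
Variables (A : 'M[R[i]]_n) (B : 'M[R[i]]_(n, m)) (C : 'M[R[i]]_(p, n))
  (D : 'M[R[i]]_(p, m)) (E : 'M[R[i]]_n).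

Definition pencil_spectrum k (M F : 'M[R[i]]_k) : set R[i] :=
  [set lambda | exists2 v : 'cV[R[i]]_k,
     v != 0 & M *m v = lambda *: (F *m v)].

Definition singular_pencil k (S T : 'M[R[i]]_k) : Prop :=
  forall lambda : R[i], \det (lambda *: T - S) = 0.

Definition regular_pencil k (S T : 'M[R[i]]_k) : Prop :=
  ~ singular_pencil S T.

Definition perturbed (Delta : 'M[R[i]]_(m, p)) : 'M[R[i]]_n :=
  A + B *m Delta *m invmx (1%:M - D *m Delta) *m C.

(* When eps * mxnorm2 D < 1, the bound on Delta makes 1%:M - D *m Delta
   invertible, so perturbed Delta is meaningful throughout. *)
Definition spectral_value_set (eps : R) : set R[i] :=
  [set lambda | exists2 Delta : 'M[R[i]]_(m, p),
     mxnorm2 Delta <= eps & pencil_spectrum (perturbed Delta) E lambda].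

(* For E invertible the value set is compact and the sup is a maximum. *)
Definition spectral_value_set_radius (eps : R) : R :=
  sup [set Normc.normc lambda | lambda in spectral_value_set eps].

Definition transfer (lambda : R[i]) : 'M[R[i]]_(p, m) :=
  C *m invmx (lambda *: E - A) *m B + D.

Definition Rmx (gamma : R) : 'M[R[i]]_m := D^t* *m D - (gamma ^+ 2)%:C%:M.
Definition Smx (gamma : R) : 'M[R[i]]_p := D *m D^t* - (gamma ^+ 2)%:C%:M.

Definition pencilS (gamma r : R) : 'M[R[i]]_(n + n) :=
  block_mx
    (A - B *m invmx (Rmx gamma) *m D^t* *m C)
    (- (gamma%:C *: (B *m invmx (Rmx gamma) *m B^t*)))
    0
    (r%:C *: E^t*).

Definition pencilT (gamma r : R) : 'M[R[i]]_(n + n) :=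
  block_mx
    (r%:C *: E)
    0
    (- (gamma%:C *: (C^t* *m invmx (Smx gamma) *m C)))
    (A^t* - C^t* *m D *m invmx (Rmx gamma) *m B^t*).

End SpectralValueSets.

(* Main.v *)
Require Import Defs.
From mathcomp Require Import all_boot all_order all_algebra.
From mathcomp Require Import complex.
From mathcomp Require Import all_classical all_reals all_analysis.
From mathcomp Require Import ring lra.

Set Implicit Arguments.
Unset Strict Implicit.
Unset Printing Implicit Defensive.

Import Order.TTheory GRing.Theory Num.Theory.
Import numFieldNormedType.Exports.

Local Open Scope classical_set_scope.
Local Open Scope ring_scope.
Local Open Scope complex_scope.
Local Open Scope sesquilinear_scope.

(** Write [G] for the transfer function and [gamma] for [eps^-1]. Away from the
    eigenvalues of [(A, E)], a perturbation of rank one shows that [z] belongs to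
    the spectral value set iff [gamma * |u| <= |G z u|] for some nonzero [u]
    ([spectral_value_setP]), that is, iff the largest singular value of [G z] is
    at least [gamma]. All eigenvalues have modulus less than [eta], so on
    [|z| > eta] the transfer function is continuous: points where the inequality
    is strict for some [u] are interior, points outside of the set have a
    neighbourhood outside of it, and at a boundary point [gamma] is exactly the
    largest singular value of [G z].

    For [|l| = 1], the pencil of radius [r] has the eigenvalue [l] iff [gamma] is
    a singular value of [G (r l)] ([pencil_detP]). Along a fixed ray its
    determinant is a nonzero multiple of a characteristic polynomial in [r], so
    the ray meets the boundary finitely often ([boundary_radii_finite]). It does
    meet it: it starts in the interior and leaves the set, because [G] tends to
    [D] at infinity and the norm of [D] is less than [gamma]
    ([boundary_radii_neq0]).

    Let [r0 = eta + delta]. The annulus [eta <= |z| <= r0] is contained in the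
    set, and since [delta] cannot be increased, compactness of the circle yields
    a point of modulus [r0] that is not interior ([delta_touches]).

    If the pencil is regular at [r0], it has finitely many eigenvalues on the unit
    circle; in every other direction the point of modulus [r0] is interior, so the
    first boundary radius is larger than [r0]. The exceptional angles are
    countably many, hence negligible.

    If the pencil is singular at [r0], then [gamma] is a singular value of [G] all
    along the circle of radius [r0]. At a point where it is the largest one, it is
    simple, so [G] contracts the hyperplane orthogonal to the top singular vector
    strictly below [gamma]; this persists nearby, and leaves room for one singular
    value not less than [gamma] only, which is [gamma] itself. The points of the
    circle where [gamma] is the largest singular value thus form an open set,
    which is also closed and nonempty: it is the whole circle
    ([circle_contraction]). The maximum modulus principle, applied to the rational
    functions [v^* G u] of [1 / z], then shows that [gamma] is not reached beyond
    the circle ([outside_notin]), so that the set ends exactly at [r0]. *)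

Local Arguments Normc.normc : simpl never.

(** * Euclidean norms and Gram matrices *)

Section Euclidean.
Variable R : realType.
Local Notation C := R[i].
Local Notation normc := (@Normc.normc R).

(** Squared Euclidean norm. *)
Definition sqn k (x : 'cV[C]_k) : R := \sum_(i < k) normc (x i 0) ^+ 2.

(** Hermitian inner product, conjugate-linear in its first argument. *)
Definition dotc k (x y : 'cV[C]_k) : C := (x^t* *m y) 0 0.

Lemma normr_normc (z : C) : `|z| = (normc z)%:C.
Proof. by []. Qed.

Lemma normc_ge0 (z : C) : 0 <= normc z.
Proof. by rewrite -ler0c -normr_normc. Qed.

Lemma conjM (z : C) : Num.conj z * z = (normc z ^+ 2)%:C.
Proof. by rewrite mulrC -normCK normr_normc rmorphXn. Qed.

Lemma conj_real (a : R) : Num.conj a%:C = a%:C :> C.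
Proof. exact: conjc_real. Qed.

Lemma normc_conj (z : C) : normc (Num.conj z) = normc z.
Proof. by apply: complexI; rewrite -!normr_normc norm_conjC. Qed.

Lemma normc_eq0 (z : C) : (normc z == 0) = (z == 0).
Proof. by rewrite -[RHS]normr_eq0 normr_normc (inj_eq (@complexI _)). Qed.

Lemma normc_real (a : R) : normc a%:C = `|a|.
Proof. by rewrite /Normc.normc /= expr0n /= addr0 sqrtr_sqr. Qed.

Lemma normc_sum (I : Type) (r : seq I) (P : pred I) (F : I -> C) :
  normc (\sum_(i <- r | P i) F i) <= \sum_(i <- r | P i) normc (F i).
Proof.
rewrite -lecR -normr_normc rmorph_sum /=.
by under [leRHS]eq_bigr do rewrite -normr_normc; exact: ler_norm_sum.
Qed.

Lemma sqn_ge0 k (x : 'cV[C]_k) : 0 <= sqn x.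
Proof. by apply: sumr_ge0 => i _; exact: sqr_ge0. Qed.

Lemma sqr_vnorm2 k (x : 'cV[C]_k) : vnorm2 x ^+ 2 = sqn x.
Proof. by rewrite sqr_sqrtr // sqn_ge0. Qed.

Lemma vnorm2_ge0 k (x : 'cV[C]_k) : 0 <= vnorm2 x.
Proof. exact: sqrtr_ge0. Qed.

Lemma vnorm2_eq0 k (x : 'cV[C]_k) : (vnorm2 x == 0) = (x == 0).
Proof.
have -> : (vnorm2 x == 0) = (vnorm2 x ^+ 2 == 0) by rewrite expf_eq0.
rewrite sqr_vnorm2 psumr_eq0; last by move=> i _; exact: sqr_ge0.
apply/idP/eqP => [/allP x0|->].
  apply/colP => i; have := x0 i (mem_index_enum _).
  by rewrite /= expf_eq0 /= normc_eq0 mxE => /eqP.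
by apply/allP => i _; rewrite /= mxE Normc.normc0 expr0n.
Qed.

Lemma vnorm2_0 k : vnorm2 (0 : 'cV[C]_k) = 0.
Proof. by apply/eqP; rewrite vnorm2_eq0. Qed.

Lemma vnorm2_gt0 k (x : 'cV[C]_k) : (0 < vnorm2 x) = (x != 0).
Proof. by rewrite lt_def vnorm2_eq0 vnorm2_ge0 andbT. Qed.

Lemma vnorm2Z k (a : C) (x : 'cV[C]_k) : vnorm2 (a *: x) = normc a * vnorm2 x.
Proof.
rewrite -[LHS]/(Num.sqrt (sqn _)) /sqn; under eq_bigr do rewrite mxE Normc.normcM exprMn.
by rewrite -mulr_sumr sqrtrM ?sqr_ge0 // sqrtr_sqr ger0_norm ?normc_ge0.
Qed.

Lemma vnorm2N k (x : 'cV[C]_k) : vnorm2 (- x) = vnorm2 x.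
Proof. by rewrite -scaleN1r vnorm2Z normcN Normc.normc1 mul1r. Qed.

Lemma dotcE k (x y : 'cV[C]_k) : dotc x y = \sum_i Num.conj (x i 0) * y i 0.
Proof. by rewrite /dotc mxE; apply: eq_bigr => i _; rewrite !mxE. Qed.

Lemma dotcc k (x : 'cV[C]_k) : dotc x x = (vnorm2 x ^+ 2)%:C.
Proof.
by rewrite dotcE sqr_vnorm2 /sqn rmorph_sum; apply: eq_bigr => i _; rewrite conjM.
Qed.

Lemma dotc_adj k l (M : 'M[C]_(k, l)) x y : dotc x (M *m y) = dotc (M^t* *m x) y.
Proof. by rewrite /dotc trmx_mul map_mxM trmxCK mulmxA. Qed.

Lemma dotc_conj k (x y : 'cV[C]_k) : dotc x y = Num.conj (dotc y x).
Proof.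
have conjMC (a b : C) : Num.conj a * b = Num.conj (Num.conj b * a).
  by rewrite rmorphM mulrC /= -[in RHS]/(Num.conj _) [in RHS]conjCK.
by rewrite !dotcE rmorph_sum; apply: eq_bigr => i _; exact: conjMC.
Qed.

Lemma dotcDr k (x y z : 'cV[C]_k) : dotc x (y + z) = dotc x y + dotc x z.
Proof. by rewrite /dotc mulmxDr mxE. Qed.

Lemma dotcZr k a (x y : 'cV[C]_k) : dotc x (a *: y) = a * dotc x y.
Proof. by rewrite /dotc -scalemxAr mxE. Qed.

Lemma dotcZl k a (x y : 'cV[C]_k) : dotc (a *: x) y = Num.conj a * dotc x y.
Proof. by rewrite !dotcE mulr_sumr; apply: eq_bigr => i _; rewrite mxE rmorphM mulrA. Qed.

Lemma sum_normcM_le k (x y : 'cV[C]_k) :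
  \sum_i normc (x i 0) * normc (y i 0) <= vnorm2 x * vnorm2 y.
Proof.
have [->|x0] := eqVneq x 0.
  rewrite vnorm2_0 mul0r big1 // => i _.
  by rewrite mxE [normc 0]Normc.normc0 mul0r.
have [->|y0] := eqVneq y 0.
  rewrite vnorm2_0 mulr0 big1 // => i _.
  by rewrite [(0 : 'cV_k) i 0]mxE [normc 0]Normc.normc0 mulr0.
set X := vnorm2 x; set Y := vnorm2 y.
have X0 : 0 < X by rewrite vnorm2_gt0.
have Y0 : 0 < Y by rewrite vnorm2_gt0.
have XY0 : 0 < 2 * (X * Y) by rewrite !mulr_gt0.
rewrite -(ler_pM2l XY0) mulr_sumr.
apply: (@le_trans _ _ (\sum_i (Y ^+ 2 * normc (x i 0) ^+ 2 +
                               X ^+ 2 * normc (y i 0) ^+ 2))).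
  apply: ler_sum => i _.
  have := sqr_ge0 (Y * normc (x i 0) - X * normc (y i 0)); nra.
rewrite big_split /= -!mulr_sumr -[\sum_i normc (x i 0) ^+ 2]/(sqn x).
rewrite -[\sum_i normc (y i 0) ^+ 2]/(sqn y) -!sqr_vnorm2 -/X -/Y.
suff -> : 2 * (X * Y) * (X * Y) = Y ^+ 2 * X ^+ 2 + X ^+ 2 * Y ^+ 2 by [].
by ring.
Qed.

Lemma cauchy_schwarz k (x y : 'cV[C]_k) :
  normc (dotc x y) <= vnorm2 x * vnorm2 y.
Proof.
rewrite dotcE (le_trans (normc_sum _ _ _)) // (le_trans _ (sum_normcM_le _ _)) //.
by apply: ler_sum => i _; rewrite Normc.normcM normc_conj.
Qed.

Lemma vnorm2D k (x y : 'cV[C]_k) : vnorm2 (x + y) <= vnorm2 x + vnorm2 y.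
Proof.
rewrite -(@ler_pXn2r _ 2) ?nnegrE ?addr_ge0 ?vnorm2_ge0 //.
rewrite sqrrD !sqr_vnorm2.
apply: (@le_trans _ _ (sqn x + (\sum_i normc (x i 0) * normc (y i 0)) *+ 2 + sqn y)).
  rewrite /sqn -sumrMnl -!big_split /=; apply: ler_sum => i _.
  rewrite mxE -sqrrD ler_pXn2r ?nnegrE ?addr_ge0 ?normc_ge0 //.
  exact: le_normcD.
by rewrite lerD2r lerD2l lerMn2r /= sum_normcM_le.
Qed.

Lemma normc_le_vnorm2 k (x : 'cV[C]_k) i : normc (x i 0) <= vnorm2 x.
Proof.
rewrite -(@ler_pXn2r _ 2) ?nnegrE ?vnorm2_ge0 ?normc_ge0 // sqr_vnorm2.
rewrite /sqn (bigD1 i) //= lerDl.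
by apply: sumr_ge0 => j _; exact: sqr_ge0.
Qed.

Lemma vnorm2_isometry k l (U : 'M[C]_(k, l)) x :
  U^t* *m U = 1%:M -> vnorm2 (U *m x) = vnorm2 x.
Proof.
move=> UU; apply/eqP; rewrite -(@eqrXn2 _ 2) ?vnorm2_ge0 //.
by rewrite -(inj_eq (@complexI _)) -!dotcc dotc_adj mulmxA UU mul1mx.
Qed.

(** A bound of the operator norm of a matrix also bounds that of its adjoint. *)
Lemma vnorm2_adj_le k l (M : 'M[C]_(k, l)) (g : R) : 0 <= g ->
  (forall u, vnorm2 (M *m u) <= g * vnorm2 u) ->
  forall v, vnorm2 (M^t* *m v) <= g * vnorm2 v.
Proof.
move=> g0 Mg v; set w := M^t* *m v.
have [->|w0] := eqVneq w 0; first by rewrite vnorm2_0 mulr_ge0 ?vnorm2_ge0.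
have w_gt0 : 0 < vnorm2 w by rewrite vnorm2_gt0.
rewrite -(ler_pM2l w_gt0) -expr2.
have -> : vnorm2 w ^+ 2 = normc (dotc (M *m w) v).
  rewrite -[M]trmxCK -dotc_adj -/w dotcc normc_real ger0_norm //.
  exact: sqr_ge0.
rewrite (le_trans (cauchy_schwarz _ _)) // mulrA [vnorm2 w * g]mulrC.
by rewrite ler_wpM2r ?vnorm2_ge0.
Qed.

Lemma vnorm2_le_sum k (x : 'cV[C]_k) : vnorm2 x <= \sum_i normc (x i 0).
Proof.
have s0 : 0 <= \sum_i normc (x i 0) by apply: sumr_ge0 => ? _; exact: normc_ge0.
rewrite -(@ler_pXn2r _ 2) ?nnegrE ?vnorm2_ge0 // sqr_vnorm2 expr2 mulr_suml /sqn.
apply: ler_sum => i _; rewrite expr2 ler_wpM2l ?normc_ge0 // (bigD1 i) //=.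
by rewrite lerDl sumr_ge0 // => ? _; exact: normc_ge0.
Qed.

(** Sum of the moduli of the entries, a crude bound of the operator norm that is
    visibly small when the entries are. *)
Definition entry_sum k l (M : 'M[C]_(k, l)) : R := \sum_i \sum_j normc (M i j).

Lemma vnorm2_entry_sum k l (M : 'M[C]_(k, l)) x :
  vnorm2 (M *m x) <= entry_sum M * vnorm2 x.
Proof.
rewrite (le_trans (vnorm2_le_sum _)) // /entry_sum mulr_suml.
apply: ler_sum => i _; rewrite mxE (le_trans (normc_sum _ _ _)) // mulr_suml.
apply: ler_sum => j _.
by rewrite Normc.normcM ler_wpM2l ?normc_ge0 ?normc_le_vnorm2.
Qed.

Lemma vnorm2_mxnorm2 k l (M : 'M[C]_(k, l)) x :
  vnorm2 (M *m x) <= mxnorm2 M * vnorm2 x.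
Proof.
have [->|x0] := eqVneq x 0; first by rewrite mulmx0 !vnorm2_0 mulr0.
have x_gt0 : 0 < vnorm2 x by rewrite vnorm2_gt0.
have xE : normc ((vnorm2 x)^-1)%:C = (vnorm2 x)^-1.
  by rewrite normc_real ger0_norm // invr_ge0 ltW.
rewrite -ler_pdivrMr // mulrC -xE -vnorm2Z scalemxAr.
apply: ub_le_sup; last first.
  by exists ((vnorm2 x)^-1%:C *: x) => //=; rewrite vnorm2Z xE mulVf ?gt_eqF.
exists (entry_sum M) => _ [y /= y1 <-].
rewrite (le_trans (vnorm2_entry_sum _ _)) // ler_piMr //.
by do 2 apply: sumr_ge0 => ? _; exact: normc_ge0.
Qed.

Lemma mxnorm2_le k l (M : 'M[C]_(k, l)) (c : R) : 0 <= c ->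
  (forall x, vnorm2 (M *m x) <= c * vnorm2 x) -> mxnorm2 M <= c.
Proof.
move=> c0 Mc; apply: ge_sup.
  by exists (vnorm2 (M *m 0)), 0 => //=; rewrite vnorm2_0.
move=> _ [y /= y1 <-]; rewrite (le_trans (Mc y)) // ler_piMr //.
Qed.

Lemma mxnorm2_ge0 k l (M : 'M[C]_(k, l)) : 0 <= mxnorm2 M.
Proof.
apply: ub_le_sup; last by exists 0; rewrite /= ?mulmx0 vnorm2_0.
exists (entry_sum M) => _ [y /= y1 <-].
rewrite (le_trans (vnorm2_entry_sum _ _)) // ler_piMr //.
by do 2 apply: sumr_ge0 => ? _; exact: normc_ge0.
Qed.

Lemma gram_normal k l (M : 'M[C]_(k, l)) : M^t* *m M \is normalmx.
Proof. by apply/normalmxP; rewrite trmx_mul map_mxM trmxCK. Qed.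

Section Spectral.
Variables (k l : nat) (M : 'M[C]_(k, l)).
Let H := M^t* *m M.
Let U := spectralmx H.
(** The eigenvalues of the Gram matrix of [M], that is, the squares of its
    singular values, as reals. *)
Definition gram_eig (i : 'I_l) : R := complex.Re (spectral_diag (M^t* *m M) 0 i).
Local Notation mu := gram_eig.

Lemma spectral_unitaryl : U^t* *m U = 1%:M.
Proof.
have Uu := spectral_unitarymx H; rewrite -(invmx_unitary Uu) mulVmx //.
exact: unitarymx_unit.
Qed.

Lemma spectral_unitaryr : U *m U^t* = 1%:M.
Proof. exact/unitarymxP/spectral_unitarymx. Qed.

Lemma gram_spectral : H = U^t* *m diag_mx (spectral_diag H) *m U.
Proof.
rewrite -(invmx_unitary (spectral_unitarymx H)).
exact/orthomx_spectralP/gram_normal.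
Qed.

Lemma spectral_delta i : U *m (U^t* *m delta_mx i 0) = delta_mx i 0 :> 'cV_l.
Proof. by rewrite mulmxA spectral_unitaryr mul1mx. Qed.

Lemma gram_delta i :
  H *m (U^t* *m delta_mx i 0) = spectral_diag H 0 i *: (U^t* *m delta_mx i 0) :> 'cV_l.
Proof.
rewrite {1}gram_spectral -!mulmxA spectral_delta [in RHS]scalemxAr.
congr (_ *m _); apply/colP => j; rewrite mul_diag_mx !mxE.
by case: eqP => [->|]; rewrite ?mulr0.
Qed.

Lemma spectral_diagE i : spectral_diag H 0 i = (mu i)%:C.
Proof.
have := gram_delta i; set d := U^t* *m delta_mx i 0 => /(congr1 (dotc d)).
have d1 : vnorm2 d = 1.
  rewrite -(vnorm2_isometry d spectral_unitaryl) spectral_delta.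
  rewrite /vnorm2 (bigD1 i) //= mxE !eqxx /= Normc.normc1 expr1n big1 ?addr0 ?sqrtr1 //.
  by move=> j /negPf ji; rewrite mxE ji Normc.normc0 expr0n.
rewrite -mulmxA dotc_adj trmxCK dotcZr !dotcc d1 expr1n mulr1 => e.
by rewrite /mu /gram_eig -/H -e.
Qed.

Lemma gram_coord (u : 'cV_l) i : (U *m (H *m u)) i 0 = (mu i)%:C * (U *m u) i 0.
Proof.
rewrite gram_spectral -!mulmxA [U *m (U^t* *m _)]mulmxA spectral_unitaryr.
by rewrite mul1mx mul_diag_mx mxE spectral_diagE.
Qed.

Lemma sqn_gram (u : 'cV_l) : sqn (M *m u) = \sum_i mu i * normc ((U *m u) i 0) ^+ 2.
Proof.
apply: complexI; rewrite -sqr_vnorm2 -dotcc dotc_adj dotc_conj.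
have -> : dotc u (M^t* *m (M *m u)) = dotc (U *m u) (U *m (H *m u)).
  by rewrite [RHS]dotc_adj [U^t* *m _]mulmxA spectral_unitaryl mul1mx mulmxA.
rewrite dotcE rmorph_sum rmorph_sum; apply: eq_bigr => i _.
rewrite gram_coord mulrCA conjM -rmorphM.
by apply/CrealP; rewrite complex_real.
Qed.

Lemma sqn_spectral (u : 'cV_l) : sqn u = \sum_i normc ((U *m u) i 0) ^+ 2.
Proof. by rewrite -sqr_vnorm2 -(vnorm2_isometry u spectral_unitaryl) sqr_vnorm2. Qed.

(** In the coordinates of the spectral basis, an eigenvector is a vector supported
    by the indices that carry its eigenvalue. *)
Lemma gram_eigvec (u : 'cV_l) (a : R) : H *m u = a%:C *: u <->
  forall i, (U *m u) i 0 != 0 -> mu i = a.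
Proof.
split=> [Hu i ui|mua].
  have := gram_coord u i; rewrite Hu -scalemxAr mxE => /(mulIf ui) e.
  by apply/esym/complexI.
rewrite -[RHS]mul1mx -[LHS]mul1mx -spectral_unitaryl -!(mulmxA (U^t*)); congr (_ *m _).
apply/colP => i; rewrite gram_coord -scalemxAr [RHS]mxE.
by have [->|/mua ->//] := eqVneq ((U *m u) i 0) 0; rewrite !mulr0.
Qed.

Lemma gram_eig_le (g : R) : 0 <= g ->
  (forall x, vnorm2 (M *m x) <= g * vnorm2 x) -> forall j, mu j <= g ^+ 2.
Proof.
move=> g0 Mg j; pose d := U^t* *m delta_mx j 0 : 'cV_l.
have := Mg d; rewrite -(@ler_pXn2r _ 2) ?nnegrE ?mulr_ge0 ?vnorm2_ge0 //.
rewrite exprMn !sqr_vnorm2 sqn_gram sqn_spectral (bigD1 j) //=.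
rewrite [in leRHS](bigD1 j) //= spectral_delta mxE !eqxx.
rewrite Normc.normc1 expr1n mulr1 !big1 ?addr0 ?mulr1 //.
  by move=> a /negPf aj; rewrite mxE aj Normc.normc0 expr0n.
by move=> a /negPf aj; rewrite mxE aj Normc.normc0 expr0n mulr0.
Qed.

(** A maximally stretched vector is a singular vector. *)
Lemma gram_eigvec_max (u : 'cV_l) (g : R) : 0 <= g ->
  (forall x, vnorm2 (M *m x) <= g * vnorm2 x) ->
  g * vnorm2 u <= vnorm2 (M *m u) -> H *m u = (g ^+ 2)%:C *: u.
Proof.
move=> g0 Mg gu; apply/gram_eigvec => i ui.
have mug := gram_eig_le g0 Mg.
have : \sum_i (g ^+ 2 - mu i) * normc ((U *m u) i 0) ^+ 2 <= 0.
  under eq_bigr do rewrite mulrBl.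
  rewrite sumrB -mulr_sumr -sqn_gram -sqn_spectral subr_le0 -!sqr_vnorm2 -exprMn.
  by rewrite ler_pXn2r ?nnegrE ?mulr_ge0 ?vnorm2_ge0.
have t0 j : 0 <= (g ^+ 2 - mu j) * normc ((U *m u) j 0) ^+ 2.
  by rewrite mulr_ge0 ?sqr_ge0 ?subr_ge0.
rewrite (bigD1 i) //= => le0.
have /eqP : (g ^+ 2 - mu i) * normc ((U *m u) i 0) ^+ 2 = 0.
  apply/le_anti; rewrite t0 andbT (le_trans _ le0) // lerDl.
  by apply: sumr_ge0 => j _.
rewrite mulf_eq0 expf_eq0 /= normc_eq0 (negPf ui) orbF subr_eq0 => /eqP.
by [].
Qed.

(** If [g] bounds the stretching and its singular vectors lie on the line of [u0],
    the stretching is uniformly below [g] on the hyperplane orthogonal to [u0]. *)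
Lemma gram_gap (u0 : 'cV_l) (g : R) : 0 < g ->
  (forall x, vnorm2 (M *m x) <= g * vnorm2 x) ->
  (forall x, H *m x = (g ^+ 2)%:C *: x -> exists a : C, x = a *: u0) ->
  exists2 c : R, 0 <= c < g &
    forall x, dotc u0 x = 0 -> vnorm2 (M *m x) <= c * vnorm2 x.
Proof.
move=> g0 Mg simple.
have mug := gram_eig_le (ltW g0) Mg.
pose c2 := \big[Num.max/0]_(i | mu i != g ^+ 2) mu i.
have c20 : 0 <= c2 by apply: bigmax_ge_id.
exists (Num.sqrt c2).
  rewrite sqrtr_ge0 /= -[ltRHS]ger0_norm ?ltW // -sqrtr_sqr ltr_sqrt ?exprn_gt0 //.
  by apply: bigmax_lt => [|i ?]; rewrite ?exprn_gt0 // lt_neqAle mug andbT.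
move=> x ux; rewrite -(@ler_pXn2r _ 2) ?nnegrE ?mulr_ge0 ?vnorm2_ge0 ?sqrtr_ge0 //.
rewrite exprMn (sqr_sqrtr c20) !sqr_vnorm2 sqn_gram sqn_spectral mulr_sumr.
apply: ler_sum => i _.
have [mui|mui] := eqVneq (mu i) (g ^+ 2).
  have [|a da] := simple (U^t* *m delta_mx i 0).
    by rewrite gram_delta spectral_diagE mui.
  have -> : (U *m x) i 0 = 0.
    have : dotc (delta_mx i 0) (U *m x) = 0.
      by rewrite dotc_adj da dotc_conj dotcZr dotc_conj ux !rmorph0 mulr0 rmorph0.
    rewrite dotcE (bigD1 i) //= mxE !eqxx rmorph1 mul1r big1 ?addr0 //.
    by move=> j /negPf ji; rewrite mxE ji rmorph0 mul0r.
  by rewrite Normc.normc0 expr0n !mulr0.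
by rewrite ler_wpM2r ?sqr_ge0 //; apply: (le_bigmax_cond _ mu).
Qed.

(** A strict contraction is a uniformly strict one, by finiteness of the spectrum. *)
Lemma gram_strict (g : R) : 0 < g ->
  (forall x, x != 0 -> vnorm2 (M *m x) < g * vnorm2 x) ->
  exists2 c : R, 0 <= c < g & forall x, vnorm2 (M *m x) <= c * vnorm2 x.
Proof.
move=> g0 Mg; have [x||c cg cP] := @gram_gap 0 _ g0.
- by have [->|/Mg/ltW//] := eqVneq x 0; rewrite mulmx0 !vnorm2_0 mulr0.
- move=> x Hx; exists 0; rewrite scale0r; apply/eqP; apply: contraT => x0.
  have := Mg _ x0; rewrite -(@ltr_pXn2r _ 2) ?nnegrE ?mulr_ge0 ?vnorm2_ge0 ?ltW //.
  rewrite exprMn -ltcR -dotcc dotc_adj dotc_conj mulmxA Hx dotcZr dotcc -rmorphM.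
  by rewrite conj_real ltxx.
- by exists c => // x; apply: cP; rewrite dotcE big1 // => i _; rewrite mxE rmorph0 mul0r.
Qed.

End Spectral.

(** If [g] occurs once in the spectrum, its eigenspace is at most a line. *)
Lemma count_sqrt_spectrum k l (M : 'M[C]_(k, l)) (g : R) : 0 <= g ->
  count_mem g (sqrt_spectrum (M^t* *m M)) = 1%N ->
  exists u0 : 'cV_l, forall x, M^t* *m M *m x = (g ^+ 2)%:C *: x ->
    exists a : C, x = a *: u0.
Proof.
move=> g0; rewrite /sqrt_spectrum count_map -size_filter.
set s := [seq _ <- _ | _]; case E: s => [|i0 [|]] // _.
have uniq_i i : gram_eig M i = g ^+ 2 -> i = i0.
  move=> mui; have : i \in s.
    by rewrite mem_filter mem_enum /= -/(gram_eig M i) mui sqrtr_sqr ger0_norm ?eqxx.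
  by rewrite E inE => /eqP.
set U := spectralmx (M^t* *m M).
exists (U^t* *m delta_mx i0 0) => x /gram_eigvec Hx.
exists ((U *m x) i0 0); rewrite scalemxAr -[LHS]mul1mx -(spectral_unitaryl M) -mulmxA.
congr (_ *m _); apply/colP => i; rewrite -/U [RHS]mxE [delta_mx _ _ _ _]mxE eqxx andbT.
have [->|ii0] := eqVneq i i0; first by rewrite mulr1.
rewrite mulr0; have [|/Hx/uniq_i e] := eqVneq ((U *m x) i 0) 0; first by [].
by rewrite e eqxx in ii0.
Qed.

(** A bound [g] that is attained on an eigenvector is the largest singular value. *)
Lemma max_sqrt_spectrum k l (M : 'M[C]_(k, l)) (g : R) (u : 'cV_l) : 0 <= g ->
  (forall x, vnorm2 (M *m x) <= g * vnorm2 x) ->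
  u != 0 -> M^t* *m M *m u = (g ^+ 2)%:C *: u ->
  \big[Num.max/0]_(s <- sqrt_spectrum (M^t* *m M)) s = g.
Proof.
move=> g0 Mg u0 /gram_eigvec Hu; apply/le_anti/andP; split.
  rewrite /sqrt_spectrum big_map; apply: bigmax_le => // i _.
  rewrite -[leRHS]ger0_norm // -sqrtr_sqr ler_wsqrtr //.
  exact: gram_eig_le.
have [i ui] : exists i, (spectralmx (M^t* *m M) *m u) i 0 != 0.
  apply/existsP; apply: contraNT u0; rewrite negb_exists => /forallP Uu0.
  rewrite -vnorm2_eq0 -(vnorm2_isometry _ (spectral_unitaryl M)) vnorm2_eq0.
  by apply/eqP/colP => i; rewrite [RHS]mxE; have /negPn/eqP := Uu0 i.
rewrite -[leLHS]ger0_norm // -sqrtr_sqr -(Hu i ui).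
rewrite /sqrt_spectrum big_map big_enum /=.
exact: (le_bigmax _ (fun i => Num.sqrt (gram_eig M i))).
Qed.

(** Multiplying by [G] identifies the eigenspaces of the two Gram matrices, so
    either one detects that the largest singular value is simple. *)
Lemma simple_singular_line k l (G : 'M[C]_(k, l)) (g : R) (u : 'cV_l) : 0 < g ->
  (forall x, vnorm2 (G *m x) <= g * vnorm2 x) ->
  u != 0 -> g * vnorm2 u <= vnorm2 (G *m u) ->
  simple_max_singular_value G ->
  exists u0 : 'cV_l, forall x, G^t* *m G *m x = (g ^+ 2)%:C *: x ->
    exists a : C, x = a *: u0.
Proof.
move=> g0 Gg u0 gu; have Hu := gram_eigvec_max (ltW g0) Gg gu.
have g2 : (g ^+ 2)%:C != 0 :> C by rewrite (inj_eq (@complexI _) _ 0) expf_eq0 gt_eqF.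
rewrite /simple_max_singular_value /max_singular_value /singular_values.
case: ifP => _; last first.
  by rewrite (max_sqrt_spectrum (ltW g0) Gg u0 Hu); apply: count_sqrt_spectrum; exact: ltW.
have GG : G *m G^t* = (G^t*)^t* *m G^t* by rewrite trmxCK.
have HGx (x : 'cV_l) : G^t* *m G *m x = (g ^+ 2)%:C *: x ->
    (G^t*)^t* *m G^t* *m (G *m x) = (g ^+ 2)%:C *: (G *m x).
  by rewrite trmxCK -!mulmxA => ->; rewrite scalemxAr.
have Gu0 : G *m u != 0.
  by rewrite -vnorm2_gt0 (lt_le_trans _ gu) // mulr_gt0 // vnorm2_gt0.
rewrite GG (max_sqrt_spectrum (ltW g0) _ Gu0 (HGx _ Hu)); last first.
  exact: vnorm2_adj_le (ltW g0) Gg.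
move=> /(count_sqrt_spectrum (ltW g0)) [w0 w0P].
exists (G^t* *m w0) => x Hx; have [a Gx] := w0P _ (HGx _ Hx).
exists ((g ^+ 2)%:C^-1 * a); apply: (scalerI g2).
by rewrite scalerA mulrA divff // mul1r -Hx -mulmxA Gx scalemxAr.
Qed.

End Euclidean.

(** * Determinants, and spectral value sets through the transfer function *)

Section Algebra.
Variable R : realType.
Local Notation C := R[i].
Local Notation normc := (@Normc.normc R).

Lemma det0_colP k (M : 'M[C]_k) :
  \det M = 0 <-> exists2 v : 'cV[C]_k, v != 0 & M *m v = 0.
Proof.
split=> [/eqP|[v v0 Mv]].
  rewrite -det_tr => /det0P[v v0 vM]; exists v^T.
    by rewrite -trmx0 (inj_eq trmx_inj).
  by rewrite -[M]trmxK -trmx_mul vM trmx0.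
apply/eqP; rewrite -det_tr; apply/det0P; exists v^T.
  by rewrite -trmx0 (inj_eq trmx_inj).
by rewrite -trmx_mul Mv trmx0.
Qed.

Lemma unitmx_colP k (M : 'M[C]_k) :
  (forall v : 'cV[C]_k, M *m v = 0 -> v = 0) -> M \in unitmx.
Proof.
move=> inj; rewrite unitmxE unitfE; apply/eqP => /det0_colP[v v0 /inj ve].
by rewrite ve eqxx in v0.
Qed.

Lemma roots_seq (P : {poly C}) : P != 0 ->
  exists rs : seq C, forall z, P.[z] = 0 -> z \in rs.
Proof.
have [rs ->] := closed_field_poly_normal P => P0; exists rs => z.
move/eqP; rewrite -rootE rootZ ?root_prod_XsubC //.
by apply: contraNneq P0 => ->; rewrite scale0r.
Qed.

(** A regular pencil has finitely many eigenvalues. *)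
Lemma det_pencil_roots k (M N : 'M[C]_k) (l0 : C) : \det (l0 *: M - N) != 0 ->
  exists rs : seq C, forall z, \det (z *: M - N) = 0 -> z \in rs.
Proof.
pose P := \det ('X *: map_mx polyC M - map_mx polyC N).
have PE z : P.[z] = \det (z *: M - N).
  rewrite -[LHS]/(horner_eval z P) -det_map_mx; congr (\det _).
  by apply/matrixP => i j; rewrite !mxE /= /horner_eval !hornerE.
move=> d0; have [|rs rsP] := @roots_seq P.
  by apply: contraNneq d0 => P0; rewrite -PE P0 horner0.
by exists rs => z; rewrite -PE => /rsP.
Qed.

(** When the leading coefficient is invertible, the pencil is regular: its
    determinant is a multiple of a characteristic polynomial. *)
Lemma det_affine_roots k (F K : 'M[C]_k) : F \in unitmx ->
  exists rs : seq C, forall z, \det (z *: F - K) = 0 -> z \in rs.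
Proof.
move=> uF; set M := invmx F *m K.
have [rs rsP] := roots_seq (monic_neq0 (char_poly_monic M)).
exists rs => z dz; apply: rsP.
have -> : (char_poly M).[z] = \det (z%:M - M).
  rewrite -[LHS]/(horner_eval z (char_poly M)) -det_map_mx; congr (\det _).
  apply/matrixP => i j; rewrite !mxE /= /horner_eval !hornerE hornerMn hornerX.
  by [].
have : \det F * \det (z%:M - M) = 0.
  by rewrite -det_mulmx mulmxBr mul_mx_scalar mulKVmx.
by move/eqP; rewrite mulf_eq0 -[_ == 0]negbK -unitfE -unitmxE uF /= => /eqP.
Qed.

Lemma mulmx_eqN k (M : 'M[C]_k) (x y : 'cV[C]_k) :
  M \in unitmx -> M *m x = - y -> x = - (invmx M *m y).
Proof. by move=> uM Mx; rewrite -mulmxN -Mx mulKmx. Qed.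

Lemma mulmx_invN k (M : 'M[C]_k) (y : 'cV[C]_k) :
  M \in unitmx -> M *m (- (invmx M *m y)) = - y.
Proof. by move=> uM; rewrite mulmxN mulKVmx. Qed.

(** The terms with the factor [c], collected. *)
Lemma block_affine k (a c : C) (M N P Q X Y : 'M[C]_k) :
  a *: block_mx (c *: X) 0 P Q - block_mx M N 0 (c *: Y) =
  c *: block_mx (a *: X) 0 0 (- Y) - (block_mx M N 0 0 - a *: block_mx 0 0 P Q).
Proof.
rewrite !(scale_block_mx, opp_block_mx, add_block_mx).
rewrite !scaler0 !(oppr0, addr0, add0r, subr0, opprK) !scalerA [a * c]mulrC.
by rewrite scalerN [- (c *: Y) + _]addrC.
Qed.

Lemma gram_shift_unit k l (M : 'M[C]_(k, l)) (g : R) :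
  (forall x, x != 0 -> vnorm2 (M *m x) < g * vnorm2 x) ->
  M^t* *m M - (g ^+ 2)%:C%:M \in unitmx.
Proof.
move=> Mg; apply: unitmx_colP => x; rewrite mulmxBl mul_scalar_mx => /eqP.
rewrite subr_eq0 => /eqP Mx; apply/eqP; apply: contraT => x0.
have x_gt0 : 0 < vnorm2 x by rewrite vnorm2_gt0.
have g0 : 0 < g.
  by rewrite -(pmulr_lgt0 _ x_gt0) (le_lt_trans (vnorm2_ge0 _) (Mg _ x0)).
have := Mg _ x0; rewrite -(@ltr_pXn2r _ 2) ?nnegrE ?mulr_ge0 ?vnorm2_ge0 ?ltW //.
rewrite exprMn -ltcR -dotcc dotc_adj dotc_conj mulmxA Mx dotcZr dotcc -rmorphM.
by rewrite conj_real ltxx.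
Qed.

End Algebra.

Section SpectralValueSet.
Variables (R : realType) (n m p : nat).
Local Notation C := R[i].
Local Notation normc := (@Normc.normc R).
Variables (A : 'M[C]_n) (B : 'M[C]_(n, m)) (Cm : 'M[C]_(p, n))
  (D : 'M[C]_(p, m)) (E : 'M[C]_n).
Local Notation G := (transfer A B Cm D E).

Lemma pencil_spectrum_unit (z : C) :
  ~ pencil_spectrum A E z -> z *: E - A \in unitmx.
Proof.
move=> nz; apply: unitmx_colP => v Zv; apply/eqP; apply: contraT => v0.
case: nz; exists v => //; apply/esym/eqP; rewrite -subr_eq0.
by rewrite scalemxAl -mulmxBl Zv.
Qed.

(** Outside of the spectrum of [(A, E)], membership in the spectral value set
    means that the transfer function stretches some vector by [eps^-1] or more. *)
Lemma spectral_value_setP (eps : R) (z : C) : 0 < eps -> eps * mxnorm2 D < 1 ->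
  z *: E - A \in unitmx ->
  spectral_value_set A B Cm D E eps z <->
  exists2 u : 'cV[C]_m, u != 0 & eps^-1 * vnorm2 u <= vnorm2 (G z *m u).
Proof.
move=> e0 eD uZ; set Z := z *: E - A.
have uD (Del : 'M[C]_(m, p)) : mxnorm2 Del <= eps -> 1%:M - D *m Del \in unitmx.
  move=> De; apply: unitmx_colP => y; rewrite mulmxBl mul1mx => /eqP.
  rewrite subr_eq0 => /eqP yE; apply/eqP; apply: contraT; rewrite -vnorm2_gt0 => y0.
  suff : vnorm2 y < vnorm2 y by rewrite ltxx.
  rewrite {1}yE -mulmxA (le_lt_trans (vnorm2_mxnorm2 _ _)) //.
  apply: (@le_lt_trans _ _ (mxnorm2 D * (eps * vnorm2 y))).
    rewrite ler_wpM2l ?mxnorm2_ge0 // (le_trans (vnorm2_mxnorm2 _ _)) //.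
    by rewrite ler_wpM2r ?vnorm2_ge0.
  by rewrite mulrA [mxnorm2 D * _]mulrC -[ltRHS]mul1r ltr_pM2r.
have GE u : G z *m u = Cm *m (invmx Z *m (B *m u)) + D *m u.
  by rewrite /transfer mulmxDl !mulmxA.
split=> [[Del De [v v0]]|[u u0 gu]].
  rewrite /perturbed; set Q := invmx _; set y := Q *m (Cm *m v); set u := Del *m y.
  have yE : y - D *m u = Cm *m v.
    have : (1%:M - D *m Del) *m y = Cm *m v by rewrite /y mulKVmx ?uD.
    by rewrite mulmxBl mul1mx -mulmxA.
  rewrite mulmxDl -!mulmxA -/y -/u => Ev.
  have Zv : Z *m v = B *m u by rewrite /Z mulmxBl -scalemxAl -Ev addrC addKr.
  have vE : v = invmx Z *m (B *m u) by rewrite -Zv mulKmx.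
  have Gu : G z *m u = y by rewrite GE -vE -yE subrK.
  exists u.
    by apply: contraNneq v0 => u0; rewrite vE u0 !mulmx0.
  rewrite Gu ler_pdivrMl // (le_trans (vnorm2_mxnorm2 _ _)) //.
  by rewrite ler_wpM2r ?vnorm2_ge0.
set y := G z *m u in gu.
have u_gt0 : 0 < vnorm2 u by rewrite vnorm2_gt0.
have y_gt0 : 0 < vnorm2 y by rewrite (lt_le_trans _ gu) // mulr_gt0 ?invr_gt0.
(* The rank-one matrix of norm [|u| / |y|] that sends [y = G u] to [u]. *)
pose Del : 'M[C]_(m, p) := ((vnorm2 y ^+ 2)^-1)%:C *: (u *m y^t*).
have DelE x : Del *m x = (((vnorm2 y ^+ 2)^-1)%:C * dotc y x) *: u.
  rewrite /Del -scalemxAl -mulmxA [y^t* *m x]mx11_scalar -/(dotc y x).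
  by rewrite mul_mx_scalar scalerA.
have De : mxnorm2 Del <= eps.
  apply: mxnorm2_le; first exact: ltW.
  move=> x; rewrite DelE vnorm2Z Normc.normcM normc_real ger0_norm; last first.
    by rewrite invr_ge0 sqr_ge0.
  rewrite -mulrA ler_pdivrMl ?exprn_gt0 //.
  apply: (@le_trans _ _ (vnorm2 y * vnorm2 x * vnorm2 u)).
    by rewrite ler_wpM2r ?vnorm2_ge0 ?cauchy_schwarz.
  rewrite ler_pdivrMl // in gu.
  have := ler_wpM2l (mulr_ge0 (ltW y_gt0) (vnorm2_ge0 x)) gu; nra.
have Dely : Del *m y = u.
  by rewrite DelE dotcc -rmorphM mulVf ?scale1r // expf_eq0 /= gt_eqF.
exists Del => //; set v := invmx Z *m (B *m u).
have yE : (1%:M - D *m Del) *m y = Cm *m v.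
  by rewrite mulmxBl mul1mx -mulmxA Dely /y GE addrK.
have Qy : invmx (1%:M - D *m Del) *m (Cm *m v) = y by rewrite -yE mulKmx ?uD.
exists v.
  apply: contraTneq y_gt0 => v0.
  by rewrite -Qy v0 !mulmx0 vnorm2_0 ltxx.
rewrite /perturbed mulmxDl -!mulmxA Qy Dely.
have <- : Z *m v = B *m u by rewrite /v mulKVmx.
by rewrite mulmxBl addrC subrK scalemxAl.
Qed.

End SpectralValueSet.

(** * Eigenvalues of the pencil and singular values of the transfer function *)

Section Pencil.
Variables (R : realType) (n m p : nat).
Local Notation C := R[i].
Local Notation normc := (@Normc.normc R).
Variables (A : 'M[C]_n) (B : 'M[C]_(n, m)) (Cm : 'M[C]_(p, n))
  (D : 'M[C]_(p, m)) (E : 'M[C]_n).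
Local Notation G := (transfer A B Cm D E).
Local Notation S_ := (pencilS A B Cm D E).
Local Notation T_ := (pencilT A B Cm D E).

Section Gamma.
Variables (gam : R).
Hypotheses (gam_gt0 : 0 < gam) (Dgam : mxnorm2 D < gam).
Local Notation Rm := (Rmx D gam).
Local Notation Sm := (Smx D gam).

Lemma mxnorm2_lt_vec x : x != 0 -> vnorm2 (D *m x) < gam * vnorm2 x.
Proof.
move=> x0; rewrite (le_lt_trans (vnorm2_mxnorm2 _ _)) // ltr_pM2r //.
by rewrite vnorm2_gt0.
Qed.

Lemma Rmx_unit : Rm \in unitmx.
Proof. exact/gram_shift_unit/mxnorm2_lt_vec. Qed.

Lemma Smx_unit : Sm \in unitmx.
Proof.
rewrite /Smx -{1}[D]trmxCK; apply: gram_shift_unit => x x0.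
apply: (@le_lt_trans _ _ (mxnorm2 D * vnorm2 x)).
  by apply: vnorm2_adj_le (mxnorm2_ge0 _) _ _ => u; exact: vnorm2_mxnorm2.
by rewrite ltr_pM2r // vnorm2_gt0.
Qed.

Lemma mul_Smx : Sm *m D = D *m Rm.
Proof. by rewrite /Smx /Rmx mulmxBl mulmxBr mulmxA mul_scalar_mx mul_mx_scalar. Qed.

Lemma mul_Rmx : Rm *m D^t* = D^t* *m Sm.
Proof. by rewrite /Smx /Rmx mulmxBl mulmxBr mulmxA mul_scalar_mx mul_mx_scalar. Qed.

Lemma mul_invRmx : D *m invmx Rm = invmx Sm *m D.
Proof.
by rewrite -[LHS]mul1mx -(mulVmx Smx_unit) -mulmxA (mulmxA Sm) mul_Smx mulmxK ?Rmx_unit.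
Qed.

Lemma mul_invSmx : D^t* *m invmx Sm = invmx Rm *m D^t*.
Proof.
by rewrite -[LHS]mul1mx -(mulVmx Rmx_unit) -mulmxA (mulmxA Rm) mul_Rmx mulmxK ?Smx_unit.
Qed.

(** Solution of a coupled system: [(a, b)] is determined by [D a - gam b] and
    [D^* b - gam a]. *)
Lemma coupled_systemP (a : 'cV[C]_m) (b : 'cV[C]_p) c e :
  D *m a - gam%:C *: b = c /\ D^t* *m b - gam%:C *: a = e <->
  a = invmx Rm *m (D^t* *m c + gam%:C *: e) /\
  b = invmx Sm *m (gam%:C *: c + D *m e).
Proof.
split=> [[<- <-]|[-> ->]]; split.
- have -> : D^t* *m (D *m a - gam%:C *: b) + gam%:C *: (D^t* *m b - gam%:C *: a) = Rm *m a.
    rewrite /Rmx mulmxBl mulmxBr mul_scalar_mx -scalemxAr scalerBr scalerA.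
    by rewrite -rmorphM -expr2 addrA subrK mulmxA.
  by rewrite mulKmx ?Rmx_unit.
- have -> : gam%:C *: (D *m a - gam%:C *: b) + D *m (D^t* *m b - gam%:C *: a) = Sm *m b.
    rewrite /Smx mulmxBl mulmxBr mul_scalar_mx -scalemxAr scalerBr scalerA.
    by rewrite -rmorphM -expr2 addrC addrA subrK mulmxA.
  by rewrite mulKmx ?Smx_unit.
- rewrite (mulmxA D) mul_invRmx -(mulmxA (invmx Sm)) (scalemxAr gam%:C) -mulmxBr.
  suff -> : D *m (D^t* *m c + gam%:C *: e) - gam%:C *: (gam%:C *: c + D *m e) = Sm *m c.
    by rewrite mulKmx ?Smx_unit.
  rewrite /Smx mulmxBl mulmxDr mul_scalar_mx -scalemxAr scalerDr scalerA.
  by rewrite -rmorphM -expr2 mulmxA opprD addrACA subrr addr0.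
- rewrite (mulmxA (D^t*)) mul_invSmx -(mulmxA (invmx Rm)) (scalemxAr gam%:C) -mulmxBr.
  suff -> : D^t* *m (gam%:C *: c + D *m e) - gam%:C *: (D^t* *m c + gam%:C *: e) = Rm *m e.
    by rewrite mulKmx ?Rmx_unit.
  rewrite /Rmx mulmxBl mulmxDr mul_scalar_mx -scalemxAr scalerDr scalerA.
  by rewrite -rmorphM -expr2 mulmxA opprD addrACA subrr add0r.
Qed.

(** With [z = r l] and [|l| = 1], the action of the pencil on a block vector
    [(x, y)] splits into the two equations [Z x + B a = 0] and
    [Z^* y + C^* b = 0], where [Z = z E - A], and [a] and [b] solve the coupled
    system of data [C x] and [B^* y]. *)
Lemma pencil_col (r : R) (l : C) (x y : 'cV[C]_n) : normc l = 1 ->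
  let Z := (r%:C * l) *: E - A in
  let a := invmx Rm *m (D^t* *m (Cm *m x) + gam%:C *: (B^t* *m y)) in
  let b := invmx Sm *m (gam%:C *: (Cm *m x) + D *m (B^t* *m y)) in
  (l *: T_ gam r - S_ gam r) *m col_mx x y =
  col_mx (Z *m x + B *m a) (- l *: (Z^t* *m y + Cm^t* *m b)).
Proof.
move=> l1 Z a b.
rewrite /pencilT /pencilS scale_block_mx opp_block_mx add_block_mx mul_block_col.
congr col_mx.
  rewrite scaler0 add0r opprK scalerA [l * _]mulrC opprB addrCA addrC mulmxDl.
  rewrite -/Z -addrA; congr (_ + _).
  by rewrite /a !mulmxDr -!scalemxAr -scalemxAl !mulmxA addrC.
have ZtE : l *: Z^t* = r%:C *: E^t* - l *: A^t*.
  rewrite /Z linearB linearZ /= map_mxB map_mxZ scalerBr scalerA; congr (_ *: _ - _).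
  rewrite rmorphM /= mulrCA -normCK normr_normc l1 expr1n mulr1.
  by rewrite conj_real.
have -> : l *: (A^t* - Cm^t* *m D *m invmx Rm *m B^t*) - r%:C *: E^t* =
    - l *: (Z^t* + Cm^t* *m (D *m invmx Rm) *m B^t*).
  rewrite [in RHS]scaleNr [in RHS]scalerDr ZtE scalerBr !mulmxA opprD opprB.
  exact: addrAC.
rewrite mul_invRmx subr0 scalerN -scaleNr -!scalemxAl -scalerDr; congr (_ *: _).
by rewrite mulmxDl addrCA /b !mulmxDr -!scalemxAr !mulmxA.
Qed.

(** On the unit circle, the eigenvalues [l] of the pencil are the points such that
    [gam] is a singular value of [G (r l)]: the kernel vectors [(x, y)] correspond
    to the pairs [(a, b)] of singular vectors, [G a = gam b] and [G^* b = gam a]. *)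
Lemma pencil_detP (r : R) (l : C) : normc l = 1 ->
  (r%:C * l) *: E - A \in unitmx ->
  \det (l *: T_ gam r - S_ gam r) = 0 <->
  exists2 a : 'cV[C]_m, a != 0 &
    (G (r%:C * l))^t* *m G (r%:C * l) *m a = (gam ^+ 2)%:C *: a.
Proof.
move=> l1 uZ; set Z := _ *: E - A in uZ; set g := G _.
have g0 : gam%:C != 0 :> C by rewrite (inj_eq (@complexI _) _ 0) gt_eqF.
have l0 : - l != 0 by rewrite oppr_eq0 -normc_eq0 l1 oner_eq0.
have uZt : Z^t* \in unitmx by rewrite map_unitmx unitmx_tr.
have gE u : g *m u = Cm *m (invmx Z *m (B *m u)) + D *m u.
  by rewrite /g /transfer mulmxDl !mulmxA.
have gtE (u : 'cV_p) : g^t* *m u = B^t* *m (invmx (Z^t*) *m (Cm^t* *m u)) + D^t* *m u.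
  rewrite /g /transfer linearD /= map_mxD mulmxDl !trmx_mul !map_mxM !mulmxA.
  by rewrite trmx_inv map_invmx.
rewrite det0_colP; split=> [[v v0]|[a a0 Ha]].
  set x := usubmx v; set y := dsubmx v; have vE : v = col_mx x y by rewrite vsubmxK.
  rewrite vE (pencil_col _ _ _ l1) -/Z.
  set a := invmx Rm *m _; set b := invmx Sm *m _.
  have [|ea eb] := (coupled_systemP a b (Cm *m x) (B^t* *m y)).2; first by [].
  rewrite -(col_mx0 _ n n 1) => /eq_col_mx[/eqP].
  rewrite addr_eq0 => /eqP Zx /eqP.
  rewrite scaler_eq0 (negPf l0) /= addr_eq0 => /eqP Zy.
  clearbody a b g Z x y.
  have xE : x = - (invmx Z *m (B *m a)) by exact: mulmx_eqN.
  have yE : y = - (invmx (Z^t*) *m (Cm^t* *m b)) by exact: mulmx_eqN.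
  have ga : g *m a = gam%:C *: b.
    by rewrite gE -[invmx Z *m _]opprK -xE mulmxN -ea opprB subrK.
  have gb : g^t* *m b = gam%:C *: a.
    by rewrite gtE -[invmx _ *m _]opprK -yE mulmxN -eb opprB subrK.
  exists a; last first.
    by rewrite -mulmxA ga -scalemxAr gb scalerA -rmorphM.
  apply: contraNneq v0 => a0.
  have b0 : b = 0.
    by apply: (scalerI g0); rewrite -ga a0 mulmx0 scaler0.
  by rewrite vE xE yE a0 b0 !mulmx0 oppr0 col_mx0.
pose b := gam%:C^-1 *: (g *m a).
have ga : g *m a = gam%:C *: b by rewrite scalerA divff // scale1r.
have gb : g^t* *m b = gam%:C *: a.
  by rewrite -scalemxAr mulmxA Ha scalerA rmorphXn expr2 mulrA mulVf // mul1r.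
pose x := - (invmx Z *m (B *m a)); pose y := - (invmx (Z^t*) *m (Cm^t* *m b)).
have [|aE bE] := (coupled_systemP a b (Cm *m x) (B^t* *m y)).1.
  split; rewrite /x /y !mulmxN.
    by rewrite -ga gE opprD addrCA subrr addr0.
  by rewrite -gb gtE opprD addrCA subrr addr0.
exists (col_mx x y).
  apply: contraNneq a0; rewrite -(col_mx0 _ n n 1) => /eq_col_mx[x0 y0].
  by rewrite aE x0 y0 !mulmx0 scaler0 addr0 mulmx0.
rewrite (pencil_col _ _ _ l1) -aE -bE -/Z.
by rewrite (mulmx_invN _ uZ) (mulmx_invN _ uZt) !addNr scaler0 col_mx0.
Qed.

(** On a fixed ray, the pencil is singular at finitely many radii only: its
    matrix is affine in [r], with invertible leading coefficient. *)
Lemma pencil_ray_finite (l : C) : l != 0 -> E \in unitmx ->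
  finite_set [set r : R | \det (l *: T_ gam r - S_ gam r) = 0].
Proof.
move=> l0 uE; pose F : 'M[C]_(n + n) := block_mx (l *: E) 0 0 (- E^t*).
have uF : F \in unitmx.
  rewrite unitmxE det_ublock unitrM detZ unitrM -scaleN1r detZ unitrM -!unitmxE uE.
  by rewrite map_unitmx unitmx_tr uE !andbT !unitfE !expf_eq0 oppr_eq0 oner_eq0 (negPf l0) !andbF.
have rE r : l *: T_ gam r - S_ gam r = r%:C *: F - (S_ gam 0 - l *: T_ gam 0).
  by rewrite /pencilT /pencilS block_affine !scale0r.
have [rs rsP] := det_affine_roots (S_ gam 0 - l *: T_ gam 0) uF.
apply: (@sub_finite_set _ _ ((real_complex R) @^-1` [set` rs])).
  by move=> r /=; rewrite rE => /rsP.
by apply: finite_preimage => //= x y _ _; exact: complexI.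
Qed.

End Gamma.
End Pencil.

(** * Continuity of matrix-valued functions *)

Section Continuity.
Variable R : realType.
Local Notation C := R[i].
Local Notation normc := (@Normc.normc R).

(** Convergence along a filter, for the topology of the modulus. *)
Definition ccvg (T : Type) (F : set_system T) (f : T -> C) (l : C) : Prop :=
  forall e : R, 0 < e -> \forall x \near F, normc (f x - l) < e.

(** Entrywise convergence of matrices. *)
Definition mx_cvg (T : Type) (F : set_system T) k l
    (M : T -> 'M[C]_(k, l)) (L : 'M[C]_(k, l)) : Prop :=
  forall i j, ccvg F (fun t => M t i j) (L i j).

Section Filter.
Context {T : Type} {F : set_system T} {FF : Filter F}.

Lemma ccvgP (f : T -> C) (l : C) :
  (f : T -> C^o) x @[x --> F] --> (l : C^o) <-> ccvg F f l.
Proof.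
split=> [/(@cvgr_dist_lt _ C^o _ _ FF) fl e e0|fl].
  have := fl e%:C; rewrite ltcR => /(_ e0); apply: filterS => x.
  by rewrite distrC normr_normc ltcR.
apply/(@cvgrPdist_lt C C^o _ _ FF) => e; rewrite ltcE /= => /andP[/eqP e2 e1].
have eE : e = (complex.Re e)%:C by case: e e2 {e1} => a b /= ->.
rewrite eE; apply: filterS (fl _ e1) => x.
by rewrite distrC normr_normc ltcR.
Qed.

Lemma ccvg_cst a : ccvg F (fun=> a) a.
Proof. by apply/ccvgP; exact: cvg_cst. Qed.

Lemma ccvgD f g a b : ccvg F f a -> ccvg F g b -> ccvg F (fun x => f x + g x) (a + b).
Proof. by move=> /ccvgP fa /ccvgP gb; apply/ccvgP; exact: (@cvgD C C^o T F FF f g a b fa gb). Qed.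

Lemma ccvgM f g a b : ccvg F f a -> ccvg F g b -> ccvg F (fun x => f x * g x) (a * b).
Proof. by move=> /ccvgP fa /ccvgP gb; apply/ccvgP; exact: (@cvgM C T F FF f g a b fa gb). Qed.

Lemma ccvgV f a : a != 0 -> ccvg F f a -> ccvg F (fun x => (f x)^-1) a^-1.
Proof. by move=> a0 /ccvgP fa; apply/ccvgP; exact: (cvgV (K := C) a0 fa). Qed.

Lemma ccvg_sum (I : Type) (r : seq I) (P : pred I) (f : I -> T -> C) (a : I -> C) :
  (forall i, P i -> ccvg F (f i) (a i)) ->
  ccvg F (fun x => \sum_(i <- r | P i) f i x) (\sum_(i <- r | P i) a i).
Proof.
move=> fa; elim: r => [|i r IH].
  by rewrite big_nil; under eq_fun do rewrite big_nil; exact: ccvg_cst.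
rewrite big_cons; under eq_fun do rewrite big_cons.
by case: ifP => [Pi|_]; [exact: ccvgD (fa _ Pi) IH|exact: IH].
Qed.

Lemma ccvg_prod (I : Type) (r : seq I) (P : pred I) (f : I -> T -> C) (a : I -> C) :
  (forall i, P i -> ccvg F (f i) (a i)) ->
  ccvg F (fun x => \prod_(i <- r | P i) f i x) (\prod_(i <- r | P i) a i).
Proof.
move=> fa; elim: r => [|i r IH].
  by rewrite big_nil; under eq_fun do rewrite big_nil; exact: ccvg_cst.
rewrite big_cons; under eq_fun do rewrite big_cons.
by case: ifP => [Pi|_]; [exact: ccvgM (fa _ Pi) IH|exact: IH].
Qed.

Lemma ccvg_horner (p : {poly C}) f a : ccvg F f a -> ccvg F (fun x => p.[f x]) p.[a].
Proof.
move=> fa; elim/poly_ind: p => [|p c IH].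
  by rewrite horner0; under eq_fun do rewrite horner0; exact: ccvg_cst.
rewrite !hornerE; under eq_fun do rewrite !hornerE.
exact: ccvgD (ccvgM IH fa) (ccvg_cst c).
Qed.

Lemma ccvg_neq0 f a : a != 0 -> ccvg F f a -> \forall x \near F, f x != 0.
Proof.
move=> a0 /(_ (normc a)); rewrite lt_def normc_eq0 a0 normc_ge0 => /(_ isT).
by apply: filterS => x; apply: contraTneq => ->; rewrite sub0r normcN ltxx.
Qed.

Lemma ccvg_eq f g a : (\forall x \near F, f x = g x) -> ccvg F f a -> ccvg F g a.
Proof.
move=> fg fa e /fa fe.
by apply: filterS2 fg fe => x ->.
Qed.

Lemma ccvg_normc f a : ccvg F f a -> normc (f x) @[x --> F] --> normc a.
Proof.
move=> fa; apply/(@cvgrPdist_lt R R^o _ _ FF) => e /fa; apply: filterS => x.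
apply: le_lt_trans; rewrite ler_norml; apply/andP; split.
  rewrite lerBrDr addrC lerBlDr -[f x in leLHS](subrK a) addrC.
  by rewrite (le_trans (le_normcD _ _)) // addrC.
rewrite lerBlDr -[a in leLHS](subrK (f x)) (le_trans (le_normcD _ _)) //.
by rewrite -normcN opprB.
Qed.

Lemma ccvg_ReIm (f : T -> C) (a : C) :
  complex.Re (f x) @[x --> F] --> complex.Re a ->
  complex.Im (f x) @[x --> F] --> complex.Im a -> ccvg F f a.
Proof.
have half (e : R) : 0 < e -> 0 < e / 2 by move=> ?; rewrite divr_gt0.
move=> /(@cvgrPdist_lt R R^o _ _ FF) fR /(@cvgrPdist_lt R R^o _ _ FF) fI.
move=> e /half e0; apply: filterS2 (fR _ e0) (fI _ e0) => x xR xI.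
rewrite [e]splitr (le_lt_trans _ (ltrD xR xI)) //.
set z := f x - a.
have -> : complex.Re a - complex.Re (f x) = - complex.Re z.
  by rewrite /z; case: (f x) => ? ?; case: (a) => ? ? /=; rewrite opprB.
have -> : complex.Im a - complex.Im (f x) = - complex.Im z.
  by rewrite /z; case: (f x) => ? ?; case: (a) => ? ? /=; rewrite opprB.
rewrite !normrN; clear.
have s0 : 0 <= `|complex.Re z| + `|complex.Im z| by rewrite addr_ge0.
rewrite -(@ler_pXn2r _ 2) ?nnegrE ?normc_ge0 //.
have -> : normc z ^+ 2 = complex.Re z ^+ 2 + complex.Im z ^+ 2.
  by apply: complexI; rewrite rmorphXn /= add_Re2_Im2 normr_normc.
rewrite sqrrD !real_normK ?num_real // lerD2r lerDl mulrn_wge0 //.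
Qed.

Section Matrices.
Variables (k l : nat).
Implicit Types (M : T -> 'M[C]_(k, l)) (L : 'M[C]_(k, l)).

Lemma mx_cvg_cst L : mx_cvg F (fun=> L) L.
Proof. by move=> i j; exact: ccvg_cst. Qed.

Lemma mx_cvgD M N L K : mx_cvg F M L -> mx_cvg F N K ->
  mx_cvg F (fun x => M x + N x) (L + K).
Proof.
move=> ML NK i j; rewrite mxE; under eq_fun do rewrite mxE.
exact: ccvgD.
Qed.

Lemma mx_cvgZ f M a L : ccvg F f a -> mx_cvg F M L ->
  mx_cvg F (fun x => f x *: M x) (a *: L).
Proof.
move=> fa ML i j; rewrite mxE; under eq_fun do rewrite mxE.
exact: ccvgM.
Qed.

Lemma mx_cvgM q M (N : T -> 'M[C]_(l, q)) L K : mx_cvg F M L -> mx_cvg F N K ->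
  mx_cvg F (fun x => M x *m N x) (L *m K).
Proof.
move=> ML NK i j; rewrite mxE; under eq_fun do rewrite mxE.
by apply: ccvg_sum => s _; exact: ccvgM.
Qed.

Lemma mx_cvg_entry_sum M L (e : R) : mx_cvg F M L -> 0 < e ->
  \forall x \near F, entry_sum (M x - L) < e.
Proof.
move=> ML e0; pose e' := e / (k * l).+1%:R.
have e'0 : 0 < e' by rewrite divr_gt0.
have : \forall x \near F, forall i j, normc (M x i j - L i j) < e'.
  by do 2 apply: filter_forall => ?; exact: ML.
apply: filterS => x Mx.
apply: (@le_lt_trans _ _ (\sum_(i < k) \sum_(j < l) e')).
  by do 2 apply: ler_sum => ? _; rewrite !mxE ltW.
rewrite !sumr_const !card_ord -mulrnA -mulr_natr /e' mulrAC ltr_pdivrMr //.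
by rewrite ltr_pM2l // ltr_nat mulnC.
Qed.

End Matrices.

Lemma ccvg_det k (M : T -> 'M[C]_k) L : mx_cvg F M L ->
  ccvg F (fun x => \det (M x)) (\det L).
Proof.
move=> ML; apply: ccvg_sum => s _; apply: ccvgM; first exact: ccvg_cst.
by apply: ccvg_prod => i _; exact: ML.
Qed.

(** The inverse is continuous, by its expression through the adjugate. *)
Lemma mx_cvg_invmx k (M : T -> 'M[C]_k) L : mx_cvg F M L -> L \in unitmx ->
  mx_cvg F (fun x => invmx (M x)) (invmx L).
Proof.
move=> ML uL; have dL : \det L != 0 by rewrite -unitfE -unitmxE.
have MLd := ccvg_det ML.
suff : mx_cvg F (fun x => (\det (M x))^-1 *: \adj (M x)) (invmx L).
  move=> MLi i j; apply: ccvg_eq (MLi i j).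
  apply: filterS (ccvg_neq0 dL MLd) => x dM.
  by rewrite /invmx unitmxE unitfE dM.
rewrite /invmx uL; apply: mx_cvgZ; first exact: ccvgV.
move=> i j; have adjE (X : 'M[C]_k) : \adj X i j = cofactor X j i by rewrite mxE.
apply: (@ccvg_eq (fun x => cofactor (M x) j i)).
  by apply: nearW => x; rewrite adjE.
apply: (eq_ind_r (ccvg F _) _ (adjE L)).
apply: ccvgM; first exact: ccvg_cst.
apply: ccvg_det => a b; rewrite !mxE; under eq_fun do rewrite !mxE.
exact: ML.
Qed.

(** A strict bound for [L] on a set of vectors, kept away from [g], persists
    for the matrices close to [L]. *)
Lemma near_stretch_lt k l (M : T -> 'M[C]_(k, l)) L (P : 'cV[C]_l -> Prop) (c g : R) :
  mx_cvg F M L -> c < g -> (forall u, P u -> vnorm2 (L *m u) <= c * vnorm2 u) ->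
  \forall x \near F, forall u, P u -> u != 0 -> vnorm2 (M x *m u) < g * vnorm2 u.
Proof.
move=> ML cg Lc; have gc : 0 < g - c by rewrite subr_gt0.
apply: filterS (mx_cvg_entry_sum ML gc) => x Mx u Pu u0.
rewrite -[M x](subrK L) mulmxDl (le_lt_trans (vnorm2D _ _)) //.
have -> : g = (g - c) + c by rewrite subrK.
rewrite mulrDl ltr_leD ?Lc // (le_lt_trans (vnorm2_entry_sum _ _)) //.
by rewrite ltr_pM2r // vnorm2_gt0.
Qed.

(** Being a strict contraction by [g] is an open condition. *)
Lemma near_strict_contraction k l (M : T -> 'M[C]_(k, l)) L (g : R) :
  mx_cvg F M L -> 0 < g -> (forall u, u != 0 -> vnorm2 (L *m u) < g * vnorm2 u) ->
  \forall x \near F, forall u, u != 0 -> vnorm2 (M x *m u) < g * vnorm2 u.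
Proof.
move=> ML g0 /(gram_strict g0) [c /andP[_ cg] Lc].
have := near_stretch_lt (P := fun=> True) ML cg (fun u _ => Lc u).
by apply: filterS => x H u; exact: H.
Qed.

(** Stretching a given vector by more than [g] is an open condition. *)
Lemma near_strict_expansion k l (M : T -> 'M[C]_(k, l)) L (g : R) u :
  mx_cvg F M L -> g * vnorm2 u < vnorm2 (L *m u) ->
  \forall x \near F, g * vnorm2 u < vnorm2 (M x *m u).
Proof.
move=> ML Lu.
have u0 : 0 < vnorm2 u.
  by rewrite vnorm2_gt0; apply: contraTneq Lu => ->; rewrite mulmx0 !vnorm2_0 mulr0 ltxx.
have d0 : 0 < (vnorm2 (L *m u) - g * vnorm2 u) / vnorm2 u.
  by rewrite divr_gt0 // subr_gt0.
apply: filterS (mx_cvg_entry_sum ML d0) => x; rewrite ltr_pdivlMr // => Mx.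
have := le_lt_trans (vnorm2_entry_sum (M x - L) u) Mx.
rewrite mulmxBl => lt1.
have : vnorm2 (L *m u) <= vnorm2 (M x *m u - L *m u) + vnorm2 (M x *m u).
  by rewrite -(vnorm2N (M x *m u - _)) opprB -[X in vnorm2 X <= _](subrK (M x *m u)) vnorm2D.
lra.
Qed.

End Filter.

(** If [G] contracts the hyperplane orthogonal to [u0] strictly below [g],
    every plane contains a vector stretched by less than [g]; so, when [g] is a
    singular value, it is the largest one. *)
Lemma contraction_of_hyperplane k l (G : 'M[C]_(k, l)) (g : R) (u0 a : 'cV[C]_l) :
  0 < g ->
  (forall u, dotc u0 u = 0 -> u != 0 -> vnorm2 (G *m u) < g * vnorm2 u) ->
  a != 0 -> G^t* *m G *m a = (g ^+ 2)%:C *: a ->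
  forall u, vnorm2 (G *m u) <= g * vnorm2 u.
Proof.
move=> g0 Gu0 a0 Ha u; rewrite leNgt; apply/negP => gu.
(* The quadratic form [|G w|^2 - g^2 |w|^2] has [a] in its kernel and is positive
   at [u]; the combination of [u] and [a] orthogonal to [u0] must make it negative. *)
pose N := G^t* *m G - (g ^+ 2)%:C%:M.
have NE w : dotc w (N *m w) = (vnorm2 (G *m w) ^+ 2 - (g * vnorm2 w) ^+ 2)%:C.
  rewrite /N mulmxBl mul_scalar_mx -mulmxA dotcDr -scaleNr dotcZr dotc_adj trmxCK.
  by rewrite !dotcc exprMn [RHS]rmorphB mulNr (rmorphM _ (g ^+ 2)).
have Nh : N^t* = N.
  rewrite /N linearB /= map_mxB trmx_mul map_mxM trmxCK tr_scalar_mx map_scalar_mx.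
  by congr (_ - _%:M); exact: conj_real.
have Na : N *m a = 0 by rewrite /N mulmxBl mul_scalar_mx Ha subrr.
have Nta (t s : C) : dotc (t *: u + s *: a) (N *m (t *: u + s *: a)) =
    (normc t ^+ 2)%:C * dotc u (N *m u).
  have Nx : N *m (t *: u + s *: a) = t *: (N *m u).
    by rewrite mulmxDr -!scalemxAr Na scaler0 addr0.
  rewrite Nx dotcZr dotc_adj Nh Nx dotcZl mulrA -conjM [Num.conj t * t]mulrC.
  by rewrite [in RHS]dotc_adj Nh.
have posu : 0 < vnorm2 (G *m u) ^+ 2 - (g * vnorm2 u) ^+ 2.
  by rewrite subr_gt0 ltr_pXn2r ?nnegrE ?mulr_ge0 ?vnorm2_ge0 ?ltW.
set w := dotc u0 a *: u + - dotc u0 u *: a.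
have u0w : dotc u0 w = 0 by rewrite dotcDr !dotcZr mulNr mulrC subrr.
have Nw : dotc w (N *m w) = (normc (dotc u0 a) ^+ 2)%:C * dotc u (N *m u) by exact: Nta.
rewrite !NE -rmorphM in Nw; move/complexI in Nw.
have [w0|w0] := eqVneq w 0.
  rewrite w0 mulmx0 !vnorm2_0 mulr0 !expr0n subrr in Nw.
  move/esym/eqP: Nw; rewrite mulf_eq0 (gt_eqF posu) orbF expf_eq0 /= normc_eq0 => /eqP ua.
  have := Gu0 _ ua a0; rewrite -(@ltr_pXn2r _ 2) ?nnegrE ?mulr_ge0 ?vnorm2_ge0 ?ltW //.
  rewrite -subr_lt0 => lt0; have := NE a; rewrite Na /dotc mulmx0 mxE => /esym/complexI.
  by move=> e; rewrite e ltxx in lt0.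
have := Gu0 _ u0w w0; rewrite -(@ltr_pXn2r _ 2) ?nnegrE ?mulr_ge0 ?vnorm2_ge0 ?ltW //.
by rewrite -subr_lt0 Nw ltNge mulr_ge0 ?sqr_ge0 // ltW.
Qed.

End Continuity.

(** * The complex plane and the maximum modulus principle *)

Section Plane.
Variable R : realType.
Local Notation C := R[i].
Local Notation normc := (@Normc.normc R).

(** Neighbourhoods for the topology of [C^o] in terms of the real modulus. *)
Lemma nbhs_normcP (z : C) (P : C -> Prop) :
  nbhs (z : C^o) (P : set C^o) <->
  exists2 e : R, 0 < e & forall w, normc (w - z) < e -> P w.
Proof.
split=> [/(@nbhs_ballP _ C^o)[e /= e0 eP]|[e e0 eP]].
  move: e0; rewrite ltcE /= => /andP[/eqP e2 e1].
  exists (complex.Re e) => // w; rewrite -ltcR -normr_normc.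
  have -> : (complex.Re e)%:C = e by case: (e) e2 => a b /= ->.
  by move=> we; apply: eP; rewrite -ball_normE /= distrC.
apply/(@nbhs_ballP _ C^o); exists e%:C => /=; first by rewrite ltcR.
by move=> w; rewrite -ball_normE /= distrC normr_normc ltcR => /eP.
Qed.

Lemma ccvg_id (z : C) : ccvg (nbhs (z : C^o)) id z.
Proof. by move=> e e0; apply/nbhs_normcP; exists e. Qed.

Lemma near_ball (z : C) (e : R) : 0 < e ->
  \forall w \near (z : C^o), normc (w - z) < e.
Proof. by move=> e0; apply/nbhs_normcP; exists e. Qed.

Lemma normc_cis (t : R) : normc (cis t) = 1.
Proof. by rewrite /Normc.normc /= cos2Dsin2 sqrtr1. Qed.

Lemma cis_neq0 (t : R) : cis t != 0 :> C.
Proof. by rewrite -normc_eq0 normc_cis oner_eq0. Qed.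

Lemma normc_polar (r t : R) : 0 <= r -> normc (r%:C * cis t) = r.
Proof. by move=> r0; rewrite Normc.normcM normc_cis mulr1 normc_real ger0_norm. Qed.

(** Every complex number has an argument in [[-pi, pi]]. *)
Lemma polar_ex (z : C) : exists2 t : R, -pi <= t <= pi & z = (normc z)%:C * cis t.
Proof.
have [->|z0] := eqVneq z 0.
  by exists 0; rewrite ?Normc.normc0 ?mul0r // oppr_le0 pi_ge0.
have n0 : 0 < normc z by rewrite lt_def normc_eq0 z0 normc_ge0.
pose x := complex.Re z / normc z; pose y := complex.Im z / normc z.
have zE : z = (normc z)%:C * (x +i* y).
  have -> : (normc z)%:C * (x +i* y) = (normc z * x) +i* (normc z * y) by simpc.
  by rewrite /x /y ![normc z * _]mulrC !divfK ?gt_eqF //; case: (z).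
have xy : x ^+ 2 + y ^+ 2 = 1.
  rewrite /x /y !expr_div_n -mulrDl.
  suff -> : complex.Re z ^+ 2 + complex.Im z ^+ 2 = normc z ^+ 2.
    by rewrite divff // expf_eq0 gt_eqF.
  by apply: complexI; rewrite add_Re2_Im2 normr_normc -rmorphXn.
have x1 : -1 <= x <= 1.
  by apply/andP; split; have := sqr_ge0 y; nra.
have cx : cos (acos x) = x by rewrite acosK // in_itv.
have sx : sin (acos x) = `|y|.
  rewrite sin_acos // -[in LHS]xy addrC addKr sqrtr_sqr //.
have a0 := acos_ge0 x1; have api := acos_lepi x1.
have [y0|y0] := leP 0 y.
  exists (acos x).
    by rewrite api (le_trans _ a0) // oppr_le0 pi_ge0.
  by rewrite {1}zE /cis cx sx ger0_norm.
exists (- acos x).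
  by rewrite lerN2 api (le_trans _ (pi_ge0 R)) // oppr_le0.
by rewrite {1}zE /cis cosN sinN cx sx ltr0_norm // opprK.
Qed.

(** Joint continuity of polar coordinates. *)
Lemma ccvg_polar (r t : R) :
  ccvg (nbhs (r, t)) (fun q : R * R => q.1%:C * cis q.2) (r%:C * cis t).
Proof.
have pE (a b : R) : a%:C * cis b = (a * cos b) +i* (a * sin b) by rewrite /cis; simpc.
rewrite pE; under eq_fun do rewrite pE.
apply: ccvg_ReIm => /=; apply: cvgM; first 1 [exact: cvg_fst].
- by apply: continuous_cvg; [exact: continuous_cos|exact: cvg_snd].
- exact: cvg_fst.
- by apply: continuous_cvg; [exact: continuous_sin|exact: cvg_snd].
Qed.

Lemma ccvg_comp (T : Type) (F : set_system T) (f : T -> C) (l : C) (P : C -> Prop) :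
  Filter F -> ccvg F f l -> (\forall w \near (l : C^o), P w) ->
  \forall x \near F, P (f x).
Proof. by move=> FF fl /nbhs_normcP[e e0 eP]; apply: filterS (fl e e0) => x /eP. Qed.

Lemma near_polar (r t : R) (P : C -> Prop) :
  (\forall w \near (r%:C * cis t : C^o), P w) ->
  \forall q \near ((r, t) : R * R), P (q.1%:C * cis q.2).
Proof. exact: (ccvg_comp _ (@ccvg_polar r t)). Qed.

Lemma near_polar_radius (r t : R) (P : C -> Prop) :
  (\forall w \near (r%:C * cis t : C^o), P w) ->
  \forall s \near r, P (s%:C * cis t).
Proof.
move/near_polar => [[U V] /= [Ur Vt] UV]; apply: filterS Ur => s Us.
by apply: (UV (s, t)); split => //=; exact: nbhs_singleton.
Qed.

Lemma near_polar_angle (r t : R) (P : C -> Prop) :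
  (\forall w \near (r%:C * cis t : C^o), P w) ->
  \forall s \near t, P (r%:C * cis s).
Proof.
move/near_polar => [[U V] /= [Ur Vt] UV]; apply: filterS Vt => s Vs.
by apply: (UV (r, s)); split => //=; exact: nbhs_singleton.
Qed.

Lemma near_normc_gt (c : R) (z : C) : c < normc z ->
  \forall w \near (z : C^o), c < normc w.
Proof.
move=> ez; have e0 : 0 < normc z - c by rewrite subr_gt0.
apply: filterS (near_ball z e0) => w.
have : normc z <= normc (w - z) + normc w.
  by rewrite -[normc (w - z)]normcN opprB -[X in normc X <= _](subrK w) le_normcD.
lra.
Qed.

Lemma cinterior_near (X : set C) (z : C) : cinterior X z ->
  \forall w \near (z : C^o), cinterior X w.
Proof. exact: nbhs_interior. Qed.

(** If the circle of radius [r] lies in the interior of [X], the neighbouring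
    circles lie in [X]. *)
Lemma near_circle_sub (X : set C) (r : R) : 0 < r ->
  (forall t, cinterior X (r%:C * cis t)) -> \forall s \near r, circle s `<=` X.
Proof.
move=> r0 rin.
have cover : \forall s \near r, `[-pi, pi]%classic `<=` (fun t => X (s%:C * cis t)).
  have cov := (compact_near_coveringP _).1 (@segment_compact R (-pi) pi).
  apply: (cov R (nbhs r) (fun s t => X (s%:C * cis t)) _) => t _.
  have [[U V] /= [Ur Vt] UV] := near_polar (rin t).
  by exists (V, U) => //= -[t' s] /= [Vt' Us]; exact: (UV (s, t')).
apply: filterS cover => s Xs z /= zs; have [t tpi ->] := polar_ex z.
by rewrite zs; apply: Xs; rewrite /= in_itv.
Qed.

(** A quotient of polynomials has no nonzero local maximum of the modulus unless
    it is constant. *)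
Lemma rational_local_max (p q : {poly C}) (a : C) (e : R) :
  let h := p.[a] / q.[a] in q.[a] != 0 -> h != 0 -> 0 < e ->
  p = h *: q \/ exists2 w, normc (w - a) < e & normc h < normc (p.[w] / q.[w]).
Proof.
move=> h qa h0 e0; pose N := p - h *: q.
have [/eqP|N0] := eqVneq N 0; first by rewrite subr_eq0 => /eqP; left.
right; have [k [N1]] := multiplicity_XsubC N a; rewrite N0 /= => rN1 NE.
have N1a : N1.[a] != 0 by exact: rN1.
have k0 : (0 < k)%N.
  case: k NE => // /(congr1 (horner^~ a)); rewrite expr0 mulr1 => Na.
  by move: N1a; rewrite -Na /N !hornerE /h divfK // subrr eqxx.
pose b := N1.[a] / q.[a]; have b0 : b != 0 by rewrite mulf_neq0 ?invr_eq0.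
(* Near [a] the quotient is [h + b (w - a)^k] up to higher order; on the ray of
   direction [om] the second term points in the direction of [h]. *)
pose om := k.-root (h / b); have omk : om ^+ k = h / b by rewrite rootCK.
have om0 : om != 0.
  have : om ^+ k != 0 by rewrite omk mulf_neq0 ?invr_eq0.
  by rewrite expf_eq0 k0.
have cvb : ccvg (nbhs (a : C^o)) (fun w => N1.[w] / q.[w] / b) 1.
  rewrite -(divff b0); apply: ccvgM (ccvg_cst _).
  by apply: ccvgM; [|apply: ccvgV => //]; apply: ccvg_horner; exact: ccvg_id.
have cvq : ccvg (nbhs (a : C^o)) (fun w => q.[w]) q.[a].
  by apply: ccvg_horner; exact: ccvg_id.
have /nbhs_normcP[d d0 dP] : \forall w \near (a : C^o),
    q.[w] != 0 /\ normc (N1.[w] / q.[w] / b - 1) < 1.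
  exact: filterI (ccvg_neq0 qa cvq) (cvb _ ltr01).
have om_gt0 : 0 < normc om by rewrite lt_def normc_eq0 om0 normc_ge0.
pose t := Num.min d e / (2 * normc om).
have t0 : 0 < t by rewrite divr_gt0 ?mulr_gt0 // lt_min d0 e0.
pose w := a + t%:C * om.
have wa : normc (w - a) < Num.min d e.
  rewrite /w addrC addKr Normc.normcM normc_real ger0_norm ?ltW // /t.
  have -> : Num.min d e / (2 * normc om) * normc om = Num.min d e / 2.
    by field; rewrite gt_eqF.
  by rewrite ltr_pdivrMr // ltr_pMr ?ltr1n // lt_min d0 e0.
move: wa; rewrite lt_min => /andP[wd we]; exists w => //.
have [qw] := dP _ wd; set be := N1.[w] / q.[w] / b => be1.
have tk0 : 0 < t ^+ k by rewrite exprn_gt0.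
have -> : p.[w] / q.[w] = h * (1 + (t ^+ k)%:C * be).
  have -> : p = N + h *: q by rewrite /N subrK.
  rewrite hornerD hornerZ mulrDl mulfK // addrC mulrDr mulr1; congr (_ + _).
  rewrite NE hornerM horner_exp !hornerE /w [a + _ - a]addrC addKr.
  rewrite exprMn omk /be /= rmorphXn /=.
  by field; rewrite b0 qw.
have h_gt0 : 0 < normc h by rewrite lt_def normc_eq0 h0 normc_ge0.
rewrite (Normc.normcM h (1 + _)) -[ltLHS]mulr1 (ltr_pM2l h_gt0).
have : normc (1 + (t ^+ k)%:C) <=
    normc (1 + (t ^+ k)%:C * be) + normc ((t ^+ k)%:C * (be - 1)).
  rewrite -[normc ((t ^+ k)%:C * (be - 1))]normcN.
  have -> : 1 + (t ^+ k)%:C = (1 + (t ^+ k)%:C * be) + - ((t ^+ k)%:C * (be - 1)).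
    by ring.
  exact: le_normcD.
rewrite Normc.normcM -(rmorphD _ 1) !normc_real !ger0_norm ?addr_ge0 ?ler01 ?(ltW tk0) //.
have : t ^+ k * normc (be - 1) < t ^+ k by rewrite gtr_pMr.
lra.
Qed.

(** Maximum modulus principle on a disc, for a quotient of polynomials. *)
Lemma rational_max_modulus (p q : {poly C}) (rho K : R) : 0 < rho ->
  (forall w, normc w <= rho -> q.[w] != 0) ->
  (forall w, normc w = rho -> normc (p.[w] / q.[w]) <= K) ->
  normc (p.[0] / q.[0]) < K ->
  forall w, normc w < rho -> normc (p.[w] / q.[w]) < K.
Proof.
move=> rho0 q0 pK p0 w0 w0rho; rewrite ltNge; apply/negP => Kw0.
pose f (x : R * R) := let w := x.1%:C * cis x.2 in normc (p.[w] / q.[w]).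
pose D := `[0, rho]%classic `*` `[-pi, pi]%classic : set (R * R).
have K0 : 0 < K by rewrite (le_lt_trans _ p0) // normc_ge0.
have [c cD cmax] : exists2 c, normc c <= rho &
    forall w, normc w <= rho -> normc (p.[w] / q.[w]) <= normc (p.[c] / q.[c]).
  have [|||c cD cP] := @compact_EVT_max _ R f D.
  - exists (0, 0); split; rewrite /= in_itv /= ?lexx ?(ltW rho0) //.
    by rewrite oppr_le0 pi_ge0.
  - by apply: compact_setX; exact: segment_compact.
  - apply: continuous_in_subspaceT => -[r t]; rewrite inE => -[/=].
    rewrite !in_itv /= => /andP[r0 rrho] _.
    have cv := @ccvg_polar r t.
    have qz : q.[r%:C * cis t] != 0 by apply: q0; rewrite normc_polar.
    exact: ccvg_normc (ccvgM (ccvg_horner p cv) (ccvgV qz (ccvg_horner q cv))).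
  - move: cD; rewrite inE => -[/=]; rewrite !in_itv /= => /andP[r0 rrho] _.
    exists (c.1%:C * cis c.2); first by rewrite normc_polar.
    move=> w wrho; have [t tpi wE] := polar_ex w.
    have := cP (normc w, t); rewrite /f /= -wE; apply.
    by rewrite inE; split; rewrite /= in_itv /= ?normc_ge0.
(* A maximum on the circle is at most [K], hence also reached at [w0]. *)
have [c' c'rho c'max] : exists2 c, normc c < rho &
    forall w, normc w <= rho -> normc (p.[w] / q.[w]) <= normc (p.[c] / q.[c]).
  have [cr|/eqP cr] := eqVneq (normc c) rho; last first.
    by exists c => //; rewrite lt_neqAle cD andbT; apply/eqP.
  by exists w0 => // w /cmax /le_trans; apply; rewrite (le_trans _ Kw0) ?pK.
set h := p.[c'] / q.[c'].
have hK : K <= normc h by rewrite (le_trans Kw0) // c'max // ltW.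
have h0 : h != 0 by rewrite -normc_eq0 gt_eqF // (lt_le_trans K0).
have gap : 0 < rho - normc c' by rewrite subr_gt0.
have qc' := q0 _ (ltW c'rho).
have [pE|[w wc]] := rational_local_max qc' h0 gap.
  move: p0; rewrite pE hornerZ mulfK ?q0 ?Normc.normc0 ?ltW //.
  by rewrite -/h ltNge hK.
rewrite ltNge c'max //.
rewrite -[w](subrK c') (le_trans (le_normcD _ _)) //; lra.
Qed.

End Plane.

(** * The real line, angles, and the transfer function at infinity *)

Section Real.
Variable R : realType.
Local Notation C := R[i].
Local Notation normc := (@Normc.normc R).

(** The infimum of a nonempty finite set of reals is a minimum. *)
Lemma finite_minimum (A : set R) : finite_set A -> A !=set0 -> minimum_of A (inf A).
Proof.
move=> fA A0; have [|c cA cmin] := compact_EVT_min (f := id) A0 (finite_compact fA).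
  by apply: continuous_subspaceT => x; exact: cvg_id.
rewrite inE in cA.
have lbc : lbound A c by move=> x Ax; apply: cmin; rewrite inE.
suff -> : inf A = c by split.
apply/le_anti/andP; split; first by apply: ge_inf => //; exists c.
exact: lb_le_inf.
Qed.

Lemma sup_attained (Y : set R) x : maximum_of Y x -> sup Y = x.
Proof.
move=> [Yx ubx]; apply/le_anti/andP; split.
  by apply: ge_sup => //; exists x.
by apply: ub_le_sup => //; exists x.
Qed.

(** A nonempty relatively clopen subset of an open interval is everything. *)
Lemma open_interval_clopen (A B : set R) : is_interval A -> open A ->
  B !=set0 -> B `<=` A ->
  (forall x, B x -> \forall y \near x, B y) ->
  (forall x, A x -> ~ B x -> \forall y \near x, ~ B y) -> A `<=` B.
Proof.
move=> iA oA B0 BA oB cB; have cA : connected A by exact/connected_intervalP.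
suff -> : B = A by [].
apply: cA => //.
  exists B; last by rewrite setIC; apply/esym/setIidl.
  by rewrite openE => x /oB.
exists (~` (A `\` B)).
  apply: open_closedC; rewrite openE => x [Ax nBx].
  have An : nbhs x A by exact: open_nbhs_nbhs.
  exact: filterI An (cB x Ax nBx).
rewrite eqEsubset; split=> x.
  by move=> Bx; split; [exact: BA|case].
by move=> [Ax nAB]; apply: contrapT => nB; apply: nAB.
Qed.

(** Two angles in the same interval between consecutive integers, which is
    shorter than [pi], are determined by their point on the unit circle. *)
Lemma cis_floor_inj (a b : R) : Num.floor a = Num.floor b -> cis a = cis b -> a = b.
Proof.
wlog ab : a b / b <= a.
  by move=> W fl ci; have [/W|/ltW/W] := leP b a; [apply|move=> ->].
move=> fl [cE sE].
have d1 : a - b <= 1.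
  have := floor_le b; have := floorD1_gt a; rewrite fl; lra.
have c1 : cos (a - b) = cos 0 by rewrite cosB cE sE cos0 -!expr2 cos2Dsin2.
apply/eqP; rewrite -subr_eq0; apply/eqP.
apply: cos_inj c1; rewrite in_itv /= ?lexx ?pi_ge0 //.
by rewrite subr_ge0 ab (le_trans d1) // (le_trans _ (pi_ge2 _)) // ler1n.
Qed.

Lemma countable_cis (rs : seq C) : countable [set t : R | cis t \in rs].
Proof.
apply/countable_injP; exists (fun t => pickle (Num.floor t, index (cis t) rs)).
move=> a b; rewrite !inE /= => ars brs /(pcan_inj pickleK)[fl ix].
by apply: cis_floor_inj => //; rewrite -(nth_index 0 ars) ix nth_index.
Qed.

Lemma uniform_prob_countable (a b : R) (ab : a < b) (N : set R) :
  countable N -> uniform_prob ab N = 0.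
Proof.
move=> cN; apply: (@dominates_uniform_prob _ _ _ ab N) => //.
  move=> A mA AN; apply: countable_lebesgue_measure0.
  exact: sub_countable (subset_card_le AN) cN.
exact: countable_measurable.
Qed.

End Real.

Section Transfer.
Variables (R : realType) (n m p : nat).
Local Notation C := R[i].
Local Notation normc := (@Normc.normc R).
Variables (A : 'M[C]_n) (B : 'M[C]_(n, m)) (Cm : 'M[C]_(p, n))
  (D : 'M[C]_(p, m)) (E : 'M[C]_n).
Local Notation G := (transfer A B Cm D E).

(** The transfer function in the variable [w = 1 / z], which extends it to the point
    at infinity [w = 0]. *)
Definition dual_transfer (w : C) : 'M[C]_(p, m) :=
  w *: (Cm *m invmx (E - w *: A) *m B) + D.

(** Change of variable [z = 1 / w] in the resolvent. *)
Lemma dual_pencil (w : C) : w != 0 -> w^-1 *: E - A = w^-1 *: (E - w *: A).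
Proof. by move=> w0; rewrite scalerBr scalerA mulVf // scale1r. Qed.

Lemma dual_pencil_unit (w : C) : w != 0 ->
  (w^-1 *: E - A \in unitmx) = (E - w *: A \in unitmx).
Proof.
by move=> w0; rewrite dual_pencil // !unitmxE detZ unitrM unitrX // unitfE invr_eq0.
Qed.

Lemma transfer_dual (w : C) : w != 0 -> E - w *: A \in unitmx ->
  G w^-1 = dual_transfer w.
Proof.
move=> w0 uw; rewrite /transfer dual_pencil // invmxZ; last first.
  by rewrite -dual_pencil // dual_pencil_unit.
by rewrite invrK -scalemxAr -scalemxAl.
Qed.

Lemma mx_cvg_transfer (z : C) : z *: E - A \in unitmx ->
  mx_cvg (nbhs (z : C^o)) G (G z).
Proof.
move=> uz; apply: mx_cvgD; last exact: mx_cvg_cst.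
apply: mx_cvgM; last exact: mx_cvg_cst.
apply: mx_cvgM; first exact: mx_cvg_cst.
apply: mx_cvg_invmx uz; apply: mx_cvgD; last exact: mx_cvg_cst.
apply: mx_cvgZ; [exact: ccvg_id|exact: mx_cvg_cst].
Qed.

Lemma mx_cvg_dual_transfer (w : C) : E - w *: A \in unitmx ->
  mx_cvg (nbhs (w : C^o)) dual_transfer (dual_transfer w).
Proof.
move=> uw; apply: mx_cvgD; last exact: mx_cvg_cst.
apply: mx_cvgZ; first exact: ccvg_id.
apply: mx_cvgM; last exact: mx_cvg_cst.
apply: mx_cvgM; first exact: mx_cvg_cst.
have uE (x : C) : E - x *: A = E + (- x) *: A by rewrite scaleNr.
rewrite uE in uw; rewrite uE; under eq_fun do rewrite uE.
apply: mx_cvg_invmx uw; apply: mx_cvgD; first exact: mx_cvg_cst.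
apply: mx_cvgZ; last exact: mx_cvg_cst.
move=> e e0; have := near_ball w e0; apply: filterS => x.
by rewrite -opprD normcN.
Qed.

(** The sesquilinear forms of the transfer function are rational. *)
Lemma dual_transfer_rational (u : 'cV[C]_m) (v : 'cV[C]_p) :
  exists P Q : {poly C}, forall w, E - w *: A \in unitmx ->
    Q.[w] != 0 /\ dotc v (dual_transfer w *m u) = P.[w] / Q.[w].
Proof.
set EX := map_mx polyC E - 'X *: map_mx polyC A.
pose P1 := (map_mx polyC (v^t* *m Cm) *m \adj EX *m map_mx polyC (B *m u)) 0 0.
exists ('X * P1 + \det EX * (dotc v (D *m u))%:P), (\det EX) => w uw.
have EXw : map_mx (horner_eval w) EX = E - w *: A.
  by apply/matrixP => i j; rewrite !mxE /= /horner_eval !hornerE.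
have polyCK k l (M : 'M[C]_(k, l)) : map_mx (horner_eval w) (map_mx polyC M) = M.
  by apply/matrixP => i j; rewrite !mxE /= /horner_eval hornerC.
have dw : (\det EX).[w] = \det (E - w *: A).
  by rewrite -[LHS]/(horner_eval w (\det EX)) -det_map_mx EXw.
have P1w : P1.[w] = (v^t* *m Cm *m \adj (E - w *: A) *m (B *m u)) 0 0.
  transitivity (map_mx (horner_eval w)
    (map_mx polyC (v^t* *m Cm) *m \adj EX *m map_mx polyC (B *m u)) 0 0).
    by rewrite mxE.
  by rewrite !map_mxM map_mx_adj EXw !polyCK.
have d0 : \det (E - w *: A) != 0 by rewrite -unitfE -unitmxE.
rewrite dw; split => //.
rewrite !hornerE dw P1w mulrDl [_ * dotc _ _]mulrC mulfK // /dual_transfer mulmxDl dotcDr.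
congr (_ + _); rewrite -scalemxAl dotcZr -mulrA; congr (_ * _).
rewrite /invmx uw -scalemxAr -!scalemxAl dotcZr mulrC; congr (_ / _).
by rewrite /dotc !mulmxA.
Qed.

End Transfer.

(** * Spectral value sets outside of the circle of radius eta *)

Section ExteriorOfSpectrum.
Variables (R : realType) (n m p : nat).
Local Notation C := R[i].
Local Notation normc := (@Normc.normc R).
Variables (A : 'M[C]_n) (B : 'M[C]_(n, m)) (Cm : 'M[C]_(p, n))
  (D : 'M[C]_(p, m)) (E : 'M[C]_n) (eps eta : R).
Local Notation G := (transfer A B Cm D E).
Local Notation sigma := (spectral_value_set A B Cm D E eps).
Local Notation gam := (eps^-1).
Hypotheses (hE : E \in unitmx) (heps : 0 < eps) (hD : eps * mxnorm2 D < 1).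
Hypotheses (heta : 0 < eta)
  (heta_encircles : forall z : C, pencil_spectrum A E z -> normc z < eta).

Let gam_gt0 : 0 < gam. Proof. by rewrite invr_gt0. Qed.

Let Dgam : mxnorm2 D < gam. Proof. by rewrite -[ltRHS]mulr1 ltr_pdivlMl. Qed.

Lemma outer_unit z : eta <= normc z -> z *: E - A \in unitmx.
Proof.
by move=> ez; apply: pencil_spectrum_unit => /heta_encircles; rewrite ltNge ez.
Qed.

Lemma outer_sigmaP z : eta <= normc z ->
  sigma z <-> exists2 u : 'cV[C]_m, u != 0 & gam * vnorm2 u <= vnorm2 (G z *m u).
Proof. by move=> ez; apply: spectral_value_setP => //; exact: outer_unit. Qed.

Lemma outer_notin z : eta <= normc z ->
  ~ sigma z <-> forall u, u != 0 -> vnorm2 (G z *m u) < gam * vnorm2 u.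
Proof.
move=> ez; split=> [nz u u0|Gz].
  rewrite ltNge; apply/negP => gu; apply: nz; apply/(outer_sigmaP ez).
  by exists u.
by move=> /(outer_sigmaP ez)[u u0]; rewrite leNgt Gz.
Qed.

Lemma expansion_interior z u : eta < normc z ->
  gam * vnorm2 u < vnorm2 (G z *m u) -> cinterior sigma z.
Proof.
move=> ez gu; have cG := mx_cvg_transfer B Cm D (outer_unit (ltW ez)).
apply: filterS2 (near_normc_gt ez) (near_strict_expansion cG gu) => w ew gw.
apply/(outer_sigmaP (ltW ew)); exists u; last exact: ltW.
by apply: contraTneq gw => ->; rewrite mulmx0 !vnorm2_0 mulr0 ltxx.
Qed.

Lemma near_notin z : eta < normc z -> ~ sigma z ->
  \forall w \near (z : C^o), ~ sigma w.
Proof.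
move=> ez /(outer_notin (ltW ez)) Gz.
have cG := mx_cvg_transfer B Cm D (outer_unit (ltW ez)).
apply: filterS2 (near_normc_gt ez) (near_strict_contraction cG gam_gt0 Gz) => w ew Gw.
exact/(outer_notin (ltW ew)).
Qed.

Lemma closure_sigma z : eta < normc z -> closure (sigma : set C^o) z -> sigma z.
Proof.
move=> ez cz; apply: contrapT => /(near_notin ez) /cz[w [wz nw]].
exact: nw.
Qed.

(** At a point that is not interior, no vector is stretched by more than [gam]. *)
Lemma not_interior_contraction z : eta < normc z -> ~ cinterior sigma z ->
  forall u, vnorm2 (G z *m u) <= gam * vnorm2 u.
Proof.
move=> ez ni u; rewrite leNgt; apply/negP => gu; apply: ni.
exact: expansion_interior gu.
Qed.

Lemma not_interior_eigvec z : eta < normc z -> sigma z -> ~ cinterior sigma z ->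
  exists2 a : 'cV[C]_m, a != 0 & (G z)^t* *m G z *m a = (gam ^+ 2)%:C *: a.
Proof.
move=> ez sz ni; have [u u0 gu] := (outer_sigmaP (ltW ez)).1 sz.
exists u => //; apply: gram_eigvec_max gu; first exact: ltW.
exact: not_interior_contraction ni.
Qed.

Lemma boundary_sigma z : eta < normc z -> cboundary sigma z ->
  sigma z /\ ~ cinterior sigma z.
Proof. by move=> ez [cz ni]; split => //; exact: closure_sigma. Qed.

Lemma boundary_radiusP t r : boundary_radii sigma eta t r <->
  [/\ eta < r, sigma (r%:C * cis t) & ~ cinterior sigma (r%:C * cis t)].
Proof.
split=> [[er /boundary_sigma[]]|[er sr ni]] //.
  by rewrite normc_polar // ltW // (lt_trans heta).
by split=> //; split=> //; exact: subset_closure.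
Qed.

Lemma outer_polar r t : eta <= r -> normc (r%:C * cis t) = r.
Proof. by move=> er; rewrite normc_polar // (le_trans (ltW heta)). Qed.

Lemma pencil_polarP r t : eta <= r ->
  \det (cis t *: pencilT A B Cm D E gam r - pencilS A B Cm D E gam r) = 0 <->
  exists2 a : 'cV[C]_m, a != 0 &
    (G (r%:C * cis t))^t* *m G (r%:C * cis t) *m a = (gam ^+ 2)%:C *: a.
Proof.
move=> er; apply: pencil_detP => //; first exact: normc_cis.
by apply: outer_unit; rewrite outer_polar.
Qed.

Lemma boundary_radii_finite t : finite_set (boundary_radii sigma eta t).
Proof.
apply: sub_finite_set (pencil_ray_finite A B Cm D gam (cis_neq0 t) hE) => r.
move=> /boundary_radiusP[er sr ni] /=; apply/(pencil_polarP t (ltW er)).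
by apply: not_interior_eigvec; rewrite ?outer_polar // ltW.
Qed.

(** The transfer function tends to [D] at infinity, and the norm of [D] is less
    than [gam]. *)
Lemma sigma_bounded : exists2 K : R, eta <= K & forall z, K < normc z -> ~ sigma z.
Proof.
have uE : E - 0 *: A \in unitmx by rewrite scale0r subr0.
have D0 u : u != 0 -> vnorm2 (dual_transfer A B Cm D E 0 *m u) < gam * vnorm2 u.
  by rewrite /dual_transfer scale0r add0r; exact: mxnorm2_lt_vec.
have near0 : \forall w \near (0 : C^o), forall u, u != 0 ->
    vnorm2 (dual_transfer A B Cm D E w *m u) < gam * vnorm2 u.
  exact: near_strict_contraction (mx_cvg_dual_transfer B Cm D uE) gam_gt0 D0.
have /nbhs_normcP[e e0 eP] := near0.
exists (Num.max eta e^-1); first by rewrite le_max lexx.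
move=> z; rewrite gt_max => /andP[ez e1z].
have z_gt0 : 0 < normc z by rewrite (lt_trans heta).
have z0 : z != 0 by rewrite -normc_eq0 gt_eqF.
apply/(outer_notin (ltW ez)) => u u0.
have w0 : z^-1 != 0 by rewrite invr_eq0.
have uw : E - z^-1 *: A \in unitmx.
  by rewrite -(dual_pencil_unit A E w0) invrK outer_unit // ltW.
have := transfer_dual B Cm D w0 uw; rewrite invrK => ->.
apply: eP => //; rewrite subr0 Normc.normcV.
by rewrite -[e]invrK ltf_pV2 ?posrE ?invr_gt0.
Qed.

(** Otherwise the ray would be split by the interior of the set and the exterior,
    which are open, whereas it starts in the former and ends in the latter. *)
Lemma boundary_radii_neq0 t : circle eta `<=` cinterior sigma ->
  boundary_radii sigma eta t !=set0.
Proof.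
move=> eta_in; apply: contrapT => /set0P/negP/negPn/eqP nob.
have [K eK KP] := sigma_bounded.
pose I := [set r : R | eta < r]; pose J := [set r | I r /\ cinterior sigma (r%:C * cis t)].
have openI r : I r -> \forall s \near r, I s.
  by move=> Ir; exact: lt_nbhsr.
suff IJ : I `<=` J.
  have [|_ /interior_subset] := IJ (K + 1).
    by rewrite /I /=; lra.
  by apply: KP; rewrite outer_polar; lra.
apply: open_interval_clopen.
- by move=> a b Ia _ c /andP[ac _]; exact: lt_le_trans ac.
- by rewrite openE => r /openI.
- have eta_t : cinterior sigma (eta%:C * cis t).
    by apply: eta_in; rewrite /circle /= outer_polar.
  have /nbhs_ballP[e /= e0 eP] := near_polar_radius (cinterior_near eta_t).
  exists (eta + e / 2); split; first by rewrite /I /= ltrDl divr_gt0.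
  apply: eP; rewrite /ball /= opprD addrA subrr add0r normrN.
  by rewrite ger0_norm ?ltr_pdivrMr ?divr_ge0 ?ltW // ltr_pMr ?ltr1n.
- by move=> r [].
- move=> r [Ir ir]; apply: filterI (openI r Ir) _.
  exact: near_polar_radius (cinterior_near ir).
- move=> r Ir nJ; have nr : ~ sigma (r%:C * cis t).
    move=> sr; have : boundary_radii sigma eta t r.
      by apply/boundary_radiusP; split=> // ir; apply: nJ.
    by rewrite nob.
  have er : eta < normc (r%:C * cis t) by rewrite outer_polar // ltW.
  apply: filterS (near_polar_radius (near_notin er nr)) => s ns [_ is_].
  exact/ns/(interior_subset is_).
Qed.

Section Radius.
Variable r0 : R.
Hypothesis eta_r0 : eta < r0.
Hypothesis annulus : forall z, eta <= normc z <= r0 -> sigma z.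

(** When the pencil is singular, that [gam] is not exceeded propagates from one point
    of the circle to all of them. *)
Lemma circle_contraction (t0 : R) :
  (forall z, sigma z -> ~ pencil_spectrum A E z -> simple_max_singular_value (G z)) ->
  singular_pencil (pencilS A B Cm D E gam r0) (pencilT A B Cm D E gam r0) ->
  ~ cinterior sigma (r0%:C * cis t0) ->
  forall t u, vnorm2 (G (r0%:C * cis t) *m u) <= gam * vnorm2 u.
Proof.
move=> hsimple hsing ni0.
have nr t : normc (r0%:C * cis t) = r0 by rewrite outer_polar // ltW.
have er t : eta < normc (r0%:C * cis t) by rewrite nr.
have uZ t := outer_unit (ltW (er t)).
have cG t := mx_cvg_transfer B Cm D (uZ t).
have eig t := (pencil_polarP t (ltW eta_r0)).1 (hsing (cis t)).
have sig t : sigma (r0%:C * cis t) by apply: annulus; rewrite nr lexx ltW.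
pose J := [set t : R | forall u, vnorm2 (G (r0%:C * cis t) *m u) <= gam * vnorm2 u].
suff IJ : setT `<=` J by move=> t; exact: IJ.
apply: open_interval_clopen => //.
- exact: openT.
- by exists t0; apply: not_interior_contraction.
- move=> t Jt; have [u u0 gu] := (outer_sigmaP (ltW (er t))).1 (sig t).
  have simple_t : simple_max_singular_value (G (r0%:C * cis t)).
    apply: hsimple (sig t) _ => /heta_encircles.
    by rewrite ltNge nr ltW.
  have [u1 u1P] := simple_singular_line gam_gt0 Jt u0 gu simple_t.
  have [c /andP[_ cg] cP] := gram_gap gam_gt0 Jt u1P.
  have near_t : \forall w \near (r0%:C * cis t : C^o), forall x, dotc u1 x = 0 ->
      x != 0 -> vnorm2 (G w *m x) < gam * vnorm2 x.
    exact: near_stretch_lt (cG t) cg cP.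
  apply: filterS (near_polar_angle near_t) => s hyp x; have [a a0 Ha] := eig s.
  exact: contraction_of_hyperplane gam_gt0 hyp a0 Ha x.
- move=> t _ /existsNP[u /negP]; rewrite -ltNge => gu.
  have near_t : \forall w \near (r0%:C * cis t : C^o),
      gam * vnorm2 u < vnorm2 (G w *m u).
    exact: near_strict_expansion (cG t) gu.
  apply: filterS (near_polar_angle near_t) => s gs Js.
  by have := Js u; rewrite leNgt gs.
Qed.

(** Maximum principle: a bound by [gam] on the circle is strict outside of it. *)
Lemma outside_notin :
  (forall t u, vnorm2 (G (r0%:C * cis t) *m u) <= gam * vnorm2 u) ->
  forall z, r0 < normc z -> ~ sigma z.
Proof.
move=> Gr0 z1 rz1.
have r0_gt0 : 0 < r0 by rewrite (lt_trans heta).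
have ez1 : eta <= normc z1 by rewrite ltW // (lt_trans eta_r0).
have z1_gt0 : 0 < normc z1 by rewrite (lt_trans r0_gt0).
have z10 : z1 != 0 by rewrite -normc_eq0 gt_eqF.
have uw w : normc w <= r0^-1 -> E - w *: A \in unitmx.
  have [->|w0] := eqVneq w 0; first by rewrite scale0r subr0.
  have w_gt0 : 0 < normc w by rewrite lt_def normc_eq0 w0 normc_ge0.
  move=> wr; rewrite -dual_pencil_unit // outer_unit // Normc.normcV.
  by rewrite (le_trans (ltW eta_r0)) // -[r0]invrK lef_pV2 ?posrE ?invr_gt0.
move=> /(outer_sigmaP ez1)[u u0 gu]; set v := G z1 *m u.
have v_gt0 : 0 < vnorm2 v by rewrite (lt_le_trans _ gu) // mulr_gt0 // vnorm2_gt0.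
have [P [Q PQ]] := dual_transfer_rational A B Cm D E u v.
have z1r : normc z1^-1 < r0^-1 by rewrite Normc.normcV ltf_pV2 ?posrE.
have r0i : 0 < r0^-1 by rewrite invr_gt0.
suff : normc (P.[z1^-1] / Q.[z1^-1]) < gam * vnorm2 u * vnorm2 v.
  have [_ <-] := PQ _ (uw _ (ltW z1r)).
  rewrite -transfer_dual ?invr_eq0 ?uw ?(ltW z1r) // invrK dotcc normc_real ger0_norm ?sqr_ge0 //.
  by rewrite expr2 ltr_pM2r // ltNge gu.
apply: (rational_max_modulus r0i) z1r.
- by move=> w /uw/PQ[].
- move=> w wr; have uww : E - w *: A \in unitmx by apply: uw; rewrite wr.
  have [_ <-] := PQ _ uww; apply: (le_trans (cauchy_schwarz _ _)).
  rewrite mulrC ler_wpM2r ?vnorm2_ge0 //.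
  have w0 : w != 0 by rewrite -normc_eq0 wr gt_eqF.
  rewrite -transfer_dual //; have [t _ ->] := polar_ex w^-1.
  by rewrite Normc.normcV wr invrK.
- have [|_ <-] := PQ 0 _; first by rewrite scale0r subr0.
  rewrite (le_lt_trans (cauchy_schwarz _ _)) // mulrC ltr_pM2r //.
  by rewrite /dual_transfer scale0r add0r mxnorm2_lt_vec.
Qed.

Lemma annulus_interior z : eta < normc z < r0 -> cinterior sigma z.
Proof.
move=> /andP[ez zr]; have e0 : 0 < r0 - normc z by rewrite subr_gt0.
apply: filterS2 (near_normc_gt ez) (near_ball z e0) => w ew wz.
apply: annulus; rewrite (ltW ew) /=.
rewrite -[w](subrK z) (le_trans (le_normcD _ _)) //; lra.
Qed.

(** There is no boundary point before the circle of radius [r0]. *)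
Lemma min_radius_ge t r : boundary_radii sigma eta t r -> r0 <= r.
Proof.
move=> /boundary_radiusP[er _ ni]; rewrite leNgt; apply/negP => rr0; apply: ni.
by apply: annulus_interior; rewrite outer_polar ?(ltW er) // er.
Qed.

End Radius.

Section Delta.
Variable delta : R.
Hypothesis hdelta : 0 < delta.
Hypothesis hdelta_max : maximum_of [set d : R | forall t : R, 0 <= t <= 1 ->
  circle (eta + t * d) `<=` sigma] delta.
Local Notation r0 := (eta + delta).

Let eta_r0 : eta < r0. Proof. by rewrite ltrDl. Qed.

(** The circles of radius [eta + t * delta] fill the annulus. *)
Lemma delta_annulus z : eta <= normc z <= r0 -> sigma z.
Proof.
move=> /andP[ez zr]; apply: (hdelta_max.1 ((normc z - eta) / delta)).
  by rewrite divr_ge0 ?subr_ge0 ?(ltW hdelta) //= ler_pdivrMr // mul1r lerBlDl.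
by rewrite /circle /= divfK ?gt_eqF // addrC subrK.
Qed.

(** Otherwise a neighbourhood of the circle would be contained in the set, and
    [delta] could be increased. *)
Lemma delta_touches : exists t, ~ cinterior sigma (r0%:C * cis t).
Proof.
apply/existsNP => rin.
have r0_gt0 : 0 < r0 by rewrite addr_gt0.
have /nbhs_ballP[e /= e0 eP] := near_circle_sub r0_gt0 rin.
have : delta + e / 2 <= delta; last first.
  by rewrite gerDl leNgt divr_gt0.
apply: hdelta_max.2 => t /= /andP[t0 t1] z zt.
have [zr|zr] := leP (normc z) r0.
  apply: delta_annulus; rewrite zr andbT zt lerDl mulr_ge0 //.
  by rewrite addr_ge0 ?divr_ge0 ?ltW.
apply: (eP (normc z)) => //; rewrite /ball /= ltr0_norm ?subr_lt0 // opprB zt.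
have : t * (delta + e / 2) <= delta + e / 2.
  by rewrite ler_piMl // addr_ge0 ?divr_ge0 ?ltW.
lra.
Qed.

End Delta.

End ExteriorOfSpectrum.

(** * The first boundary radius *)

Theorem theorem6p2 (R : realType) (n m p : nat)
    (A : 'M[R[i]]_n) (B : 'M[R[i]]_(n, m)) (C : 'M[R[i]]_(p, n))
    (D : 'M[R[i]]_(p, m)) (E : 'M[R[i]]_n) (eps eta delta : R)
    (sigma := spectral_value_set A B C D E eps)
    (gamma := eps^-1)
    (rhat := min_boundary_radius sigma eta)
    (hE : E \in unitmx)
    (heps : 0 < eps)
    (hD : eps * mxnorm2 D < 1)
    (hsimple : forall lambda : R[i], sigma lambda ->
      ~ pencil_spectrum A E lambda ->
      simple_max_singular_value (transfer A B C D E lambda))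
    (heta : 0 < eta)
    (heta_encircles : forall lambda : R[i],
      pencil_spectrum A E lambda -> Normc.normc lambda < eta)
    (heta_interior : circle eta `<=` cinterior sigma)
    (hdelta : 0 < delta)
    (hdelta_max : maximum_of
      [set d : R | forall t : R, 0 <= t <= 1 ->
         circle (eta + t * d) `<=` sigma] delta) :
  (forall theta : R, 0 <= theta < 2 * pi ->
     finite_set (boundary_radii sigma eta theta) /\
     minimum_of (boundary_radii sigma eta theta) (rhat theta)) /\
  ((singular_pencil (pencilS A B C D E gamma (eta + delta))
                    (pencilT A B C D E gamma (eta + delta)) /\
    (forall theta : R, 0 <= theta < 2 * pi -> rhat theta = eta + delta) /\
    eta + delta = spectral_value_set_radius A B C D E eps)
   \/
   (regular_pencil (pencilS A B C D E gamma (eta + delta))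
                   (pencilT A B C D E gamma (eta + delta)) /\
    {ae uniform_prob (twopi_gt0 R), forall theta : R,
       eta + delta < rhat theta})).
Proof.
have annulus := delta_annulus hdelta hdelta_max.
have [t0 ni0] := delta_touches heta hdelta hdelta_max.
set r0 := eta + delta in annulus ni0 *.
have eta_r0 : eta < r0 by rewrite ltrDl.
have outer t r : eta <= r -> Normc.normc (r%:C * cis t) = r.
  exact: (outer_polar heta t).
have minr theta : minimum_of (boundary_radii sigma eta theta) (rhat theta).
  apply: finite_minimum.
    exact: (boundary_radii_finite B C hE heps hD heta heta_encircles).
  exact: (boundary_radii_neq0 hE heps hD heta heta_encircles).
have rhat_ge theta : r0 <= rhat theta.
  exact: (min_radius_ge heps hD heta heta_encircles annulus (minr theta).1).
have rhatP theta := (boundary_radiusP B C heps hD heta heta_encircles theta _).1 (minr theta).1.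
split.
  move=> theta _; split => //.
  exact: (boundary_radii_finite B C hE heps hD heta heta_encircles).
have [hsing|hreg] := pselect (singular_pencil (pencilS A B C D E gamma r0)
                                              (pencilT A B C D E gamma r0)).
  left; split => //.
  have Gr0 := circle_contraction heps hD heta heta_encircles eta_r0 annulus hsimple hsing ni0.
  have outside := outside_notin hE heps hD heta heta_encircles eta_r0 Gr0.
  split.
    move=> theta _; apply/eqP; rewrite eq_le rhat_ge andbT leNgt; apply/negP => r0r.
    have [er sr _] := rhatP theta; apply: outside sr.
    by rewrite outer // ltW.
  apply/esym; apply: sup_attained; split.
    exists (r0%:C * cis t0); last by rewrite outer // ltW.
    by apply: annulus; rewrite outer ?lexx ?ltW // ltW.
  move=> _ [z sz <-]; rewrite leNgt; apply/negP => /outside; exact.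
right; split => //.
have [rs rsP] : exists rs : seq R[i], forall z,
    \det (z *: pencilT A B C D E gamma r0 - pencilS A B C D E gamma r0) = 0 -> z \in rs.
  have /existsNP[l0 /eqP dl0] := hreg.
  exact: det_pencil_roots dl0.
(* The angles of the finitely many eigenvalues of the pencil on the circle. *)
exists [set t | cis t \in rs]; split.
- exact/countable_measurable/countable_cis.
- exact/uniform_prob_countable/countable_cis.
- move=> theta /= /negP; rewrite -leNgt => rle; apply: rsP.
  have rE : rhat theta = r0 by apply/le_anti; rewrite rle rhat_ge.
  have [er sr ni] := rhatP theta.
  apply/(pencil_polarP B C heps hD heta heta_encircles theta (ltW eta_r0)).
  rewrite rE in sr ni.
  apply: (not_interior_eigvec heps hD heta_encircles _ sr ni).
  by rewrite outer // ltW.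
Qed.
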